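(* Let $p$ be a prime and let $X$ be an indecomposable rack with $p^2$ elements. Then $X$ is isomorphic to one of the following racks: (1) $X=\mathbb{Z}_p\oplus\mathbb{Z}_p$ with $(x_1,x_2)\triangleright (y_1,y_2)=((1-\alpha)x_1+\alpha y_1,(1-\beta)x_2+\beta y_2)$, where $\alpha,\beta\in\mathbb{Z}_p^*\setminus\{1\}$; (2) $X=\mathbb{Z}_p\oplus\mathbb{Z}_p$ with $(x_1,x_2)\triangleright (y_1,y_2)=((1-\alpha)x_1+\alpha y_1,(1-\alpha)x_2+\alpha y_2+y_1-x_1)$, where $\alpha\in\mathbb{Z}_p^*\setminus\{1\}$; (3) $X=\mathbb{F}_{p^2}$ with $x\triangleright y=(1-\alpha)x+\alpha y$, where $\alpha\in\mathbb{F}_{p^2}\setminus\mathbb{F}_p$; (4) $X=\mathbb{Z}_{p^2}$ with $x\triangleright y=(1-\alpha)x+\alpha y$, where $\alpha\not\equiv 0,1\pmod p$; (5) $X=\mathbb{Z}_{p^2}$ with $x\triangleright y=y+1$; (6) $X=\mathbb{Z}_p\oplus\mathbb{Z}_p$ with $(x_1,x_2)\triangleright(y_1,y_2)=((1-\alpha)x_1+\alpha y_1,y_2+1)$, where $\alpha\in\mathbb{Z}_p^*\setminus\{1\}$. Two racks from different items of this list are not isomorphic. Within a single item, the only isomorphisms between racks with different parameters are: in item (1), the rack with parameters $(\alpha,\beta)$ is isomorphic to the rack with parameters $(\beta,\alpha)$; in item (3), the rack with parameter $\alpha$ is isomorphic to the rack with parameter $\sigma(\alpha)$, where $\sigma$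 is the nontrivial element of $\operatorname{Gal}(\mathbb{F}_{p^2}|\mathbb{F}_p)$. (All other distinct parameter values within an item give non-isomorphic racks.)
   Context: A rack is a set $X$ with a binary operation $\triangleright:X\times X\to X$ such that each map $\phi_x:X\to X$, $\phi_x(y)=x\triangleright y$, is a bijection, and $x\triangleright(y\triangleright z)=(x\triangleright y)\triangleright(x\triangleright z)$ for all $x,y,z\in X$. An isomorphism of racks is a bijection $f$ with $f(x\triangleright y)=f(x)\triangleright f(y)$. A rack $X$ is decomposable if $X=Y\sqcup Z$ with $Y,Z$ nonempty and $X\triangleright Y=Y$, $X\triangleright Z=Z$; it is indecomposable otherwise. Here $\mathbb{Z}_n$ denotes the integers modulo $n$ and $\mathbb{F}_{p^2}$ the field with $p^2$ elements. *)

(* Defs.v *)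
From HB Require Import structures.
From mathcomp Require Import all_boot all_order all_algebra all_fingroup all_field.
Set Implicit Arguments. Unset Strict Implicit. Unset Printing Implicit Defensive.
Import GRing.Theory.
Local Open Scope ring_scope.

Definition is_rack (X : finType) (op : X -> X -> X) : Prop :=
  (forall x, bijective (op x)) /\
  (forall x y z, op x (op y z) = op (op x y) (op x z)).

Definition decomposable (X : finType) (op : X -> X -> X) : Prop :=
  exists Y Z : {set X},
    [/\ Y != set0, Z != set0, [disjoint Y & Z] & Y :|: Z = [set: X]] /\
    [set op x y | x in [set: X], y in Y] = Y /\
    [set op x z | x in [set: X], z in Z] = Z.

Definition indecomposable (X : finType) (op : X -> X -> X) : Prop :=
  ~ decomposable op.

Definition rack_iso (X Y : finType) (opX : X -> X -> X) (opY : Y -> Y -> Y) : Prop :=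
  exists f : X -> Y, bijective f /\ forall x y, f (opX x y) = opY (f x) (f y).

Definition unit_ne1 (p : nat) (a : 'F_p) : bool := (a != 0) && (a != 1).

Definition rack1 (p : nat) (a b : 'F_p) (x y : 'F_p * 'F_p) : 'F_p * 'F_p :=
  ((1 - a) * x.1 + a * y.1, (1 - b) * x.2 + b * y.2).
Definition rack2 (p : nat) (a : 'F_p) (x y : 'F_p * 'F_p) : 'F_p * 'F_p :=
  ((1 - a) * x.1 + a * y.1, (1 - a) * x.2 + a * y.2 + y.1 - x.1).
Definition rack3 (F : finFieldType) (a : F) (x y : F) : F := (1 - a) * x + a * y.
Definition rack4 (p : nat) (a : 'Z_(p ^ 2)) (x y : 'Z_(p ^ 2)) : 'Z_(p ^ 2) :=
  (1 - a) * x + a * y.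
Definition rack5 (p : nat) (x y : 'Z_(p ^ 2)) : 'Z_(p ^ 2) := y + 1.
Definition rack6 (p : nat) (a : 'F_p) (x y : 'F_p * 'F_p) : 'F_p * 'F_p :=
  ((1 - a) * x.1 + a * y.1, y.2 + 1).

Definition in_prime_subfield (F : finFieldType) (x : F) : Prop :=
  exists n : nat, x = n%:R.

Definition valid4 (p : nat) (a : 'Z_(p ^ 2)) : bool :=
  ((nat_of_ord a %% p) != 0)%N && ((nat_of_ord a %% p) != 1)%N.

Definition in_item (p : nat) (F : finFieldType) (i : nat)
    (X : finType) (op : X -> X -> X) : Prop :=
  match i with
  | 1 => exists a b : 'F_p, [/\ unit_ne1 a, unit_ne1 b & rack_iso op (rack1 a b)]
  | 2 => exists a : 'F_p, unit_ne1 a /\ rack_iso op (rack2 a)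
  | 3 => exists a : F, ~ in_prime_subfield a /\ rack_iso op (rack3 a)
  | 4 => exists a : 'Z_(p ^ 2), valid4 a /\ rack_iso op (rack4 a)
  | 5 => rack_iso op (@rack5 p)
  | 6 => exists a : 'F_p, unit_ne1 a /\ rack_iso op (rack6 a)
  | _ => False
  end%N.

(* Main.v *)
(* Let G be the inner group of the rack X, generated by the class C of a left
   translation s. Indecomposability makes G transitive, so |C| divides p^2.

   The key fact is that a finite group generated by a class C of p-power size has
   a derived group of p-power order. Suppose that y in G' has prime order q <> p.
   Let Q be a prime ideal over q of the ring of algebraic integers, and B the set of
   irreducible characters chi whose central character maps the class sum of C to
   |C| modulo Q. The characters induced to G from the linear characters of <y> are
   afforded by monomial matrices that agree modulo Q; comparing the multiplicity
   modulo Q of the root |C| in the characteristic polynomials of the class sum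
   gives sum_(chi in B) chi(1) chi(y) = 0. Every nonlinear chi in B has degree
   divisible by p (Burnside's argument), so p divides the number of linear
   characters in B; these form a group without p-torsion, a contradiction.

   Hence N := G' is a p-group. Conjugation by s fixes no nontrivial element of
   N / N', and |N : N'| >= p^2 if N is nonabelian; comparing with the size of C,
   N is abelian, acts regularly on C, and 'C_N[s] = 1. So X is N times a cycle of s,
   with (n, k) |> (n', k') = ((n' n^-1)^s n, k' + 1). The cases |N| = 1, p, p^2 give
   items (5), (6) and affine racks on abelian groups of order p^2, for which it
   remains to classify 2 x 2 matrices over F_p. Isomorphic affine racks are
   linearly conjugate, so eigenvalues separate the items and the parameters. *)
Require Import Defs.
From HB Require Import structures.
From mathcomp Require Import boolp classical_sets.
From mathcomp Require Import all_boot all_order all_algebra all_fingroup all_field.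
From mathcomp Require Import all_solvable all_character.
From mathcomp Require Import ring.
Set Implicit Arguments. Unset Strict Implicit. Unset Printing Implicit Defensive.
Import Order.TTheory GRing.Theory Num.Theory.
Local Open Scope ring_scope.

(** * Prime ideals of algebraic integers *)

Record Aint_prime_ideal (Q : pred algC) : Prop := AintPrimeIdeal {
  Aint_ideal_sub : {subset Q <= Aint};
  Aint_ideal1 : 1 \notin Q;
  Aint_idealD : {in Q &, forall a b, a + b \in Q};
  Aint_idealMl : forall a b, a \in Aint -> b \in Q -> a * b \in Q;
  Aint_ideal_prime : forall a b, a \in Aint -> b \in Aint ->
    a * b \in Q -> a \in Q \/ b \in Q }.

Lemma inv_nat_notin_Aint (q : nat) b : (1 < q)%N -> b \in Aint -> q%:R * b != 1.
Proof.
move=> q1 Zb; apply/eqP => qb1.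
have q0 : q%:R != 0 :> algC by rewrite pnatr_eq0 -lt0n (ltn_trans _ q1).
have: (q %| 1)%C by rewrite -eqAmod0_rat ?rpred_nat ?rpred1 // -qb1 eqAmodMr0.
by rewrite (dvdC_nat q 1) dvdn1 => /eqP q_1; rewrite q_1 in q1.
Qed.

(** Zorn's lemma yields a maximal element among the proper ideals containing [q], and maximality
    makes it prime. The ideal generated by [q] is proper by [inv_nat_notin_Aint]. *)
Lemma Aint_prime_ideal_over (q : nat) : (1 < q)%N ->
  exists2 Q : pred algC, Aint_prime_ideal Q & q%:R \in Q.
Proof.
move=> q1.
(* Only nonempty [A] must contain [q], so that the empty chain has a bound. *)
pose P (A : set algC) := [/\ forall a, A a -> a \in Aint, ~ A 1,
  forall a b, A a -> A b -> A (a + b),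
  forall a b, a \in Aint -> A b -> A (a * b) &
  forall a, A a -> A q%:R].
have [|A [[sA A1 AD AM Aq] maxA]] := @Zorn_bigcup _ P.
  move=> F FP totF; split.
  - by move=> a [X FX Xa]; have [s _ _ _ _] := FP _ FX; exact: s Xa.
  - by case=> X FX X1; have [_ n1 _ _ _] := FP _ FX; exact: n1 X1.
  - move=> a b [X FX Xa] [Y FY Yb]; case: (totF _ _ FX FY) => sXY.
    + by exists Y => //; have [_ _ D _ _] := FP _ FY; apply: D => //; exact: sXY.
    + by exists X => //; have [_ _ D _ _] := FP _ FX; apply: D => //; exact: sXY.
  - by move=> a b Za [X FX Xb]; exists X => //; have [_ _ _ M _] := FP _ FX; exact: M.
  - by move=> a [X FX Xa]; exists X => //; have [_ _ _ _ H] := FP _ FX; exact: H Xa.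
have Zq : q%:R \in Aint by rewrite rpred_nat.
have Aqq : A q%:R.
  have [[a /Aq]|nA] := pselect (exists a, A a); first by [].
  have A0 : forall a, ~ A a by move=> a Aa; apply: nA; exists a.
  case: (maxA [set c | exists2 b, b \in Aint & c = q%:R * b]%classic).
    split; first by move=> a /A0.
    by move/(_ q%:R) => h; apply/(A0 q%:R)/h; exists 1; rewrite ?rpred1 ?mulr1.
  split=> [a [b Zb ->]|[b Zb /esym/eqP]|a b [a' Za ->] [b' Zb ->]|a b Za [b' Zb ->]|_ _].
  - exact: rpredM.
  - by rewrite (negPf (inv_nat_notin_Aint q1 Zb)).
  - by exists (a' + b'); rewrite ?rpredD ?mulrDr.
  - by exists (a * b'); rewrite ?rpredM // mulrCA.
  - by exists 1; rewrite ?rpred1 ?mulr1.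
have A0 : A 0 by rewrite -(mul0r (q%:R)); apply: AM; rewrite ?rpred0.
(* By maximality of [A], adjoining [a] gives the unit ideal. *)
have gen1 a : a \in Aint -> ~ A a -> exists c d, [/\ c \in Aint, A d & 1 = c * a + d].
  move=> Za nAa; apply: contrapT => no1.
  case: (maxA [set e | exists c d, [/\ c \in Aint, A d & e = c * a + d]]%classic).
    split=> [e Ae|/(_ a) h]; first by exists 0, e; rewrite rpred0 mul0r add0r.
    by apply/nAa/h; exists 1, 0; rewrite rpred1 mul1r addr0.
  split=> //.
  - by move=> e [c [d [Zc /sA Zd ->]]]; rewrite rpredD ?rpredM.
  - move=> e f [c [d [Zc Ad ->]]] [c' [d' [Zc' Ad' ->]]].
    by exists (c + c'), (d + d'); rewrite rpredD // mulrDl addrACA; split; auto.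
  - move=> e f Ze [c [d [Zc Ad ->]]].
    by exists (e * c), (e * d); rewrite rpredM // mulrDr mulrA; split; auto.
  - by exists 0, q%:R; rewrite rpred0 mul0r add0r.
exists (fun a => `[< A a >]); last exact/asboolP.
split=> [a /asboolP/sA//|||a b Za /asboolP Ab|a b Za Zb /asboolP Aab].
- exact/asboolP.
- by move=> a b /asboolP Aa /asboolP Ab; apply/asboolP; exact: AD.
- by apply/asboolP; exact: AM.
apply: contrapT => /not_orP[nA nB].
have [c [d [Zc Ad e1]]] := gen1 a Za (fun h => nA (introT (asboolP _) h)).
apply: nB; apply/asboolP; rewrite -[b]mul1r e1 mulrDl -mulrA; apply: AD; first exact: AM.
by rewrite mulrC; exact: AM.
Qed.

Section RootsInIdeal.

Variables (Q : pred algC) (Qprime : Aint_prime_ideal Q).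
Let QM := Aint_idealMl Qprime.

Lemma Aint_idealN a : a \in Q -> - a \in Q.
Proof. by rewrite -mulN1r; apply: QM; rewrite rpredN rpred1. Qed.

Lemma Aint_idealNr a : (- a \in Q) = (a \in Q).
Proof. by apply/idP/idP => /Aint_idealN //; rewrite opprK. Qed.

Lemma Aint_idealDl a b : a \in Q -> (a + b \in Q) = (b \in Q).
Proof.
move=> Qa; apply/idP/idP => [Qab|]; last exact: Aint_idealD.
by rewrite -(addKr a b); apply: Aint_idealD => //; exact: Aint_idealN.
Qed.

Lemma Aint_ideal0 a : a \in Q -> 0 \in Q.
Proof. by rewrite -(mul0r a); apply: QM; rewrite rpred0. Qed.

Lemma Aint_ideal_sum I (r : seq I) (P : pred I) F : 0 \in Q ->
  (forall i, P i -> F i \in Q) -> \sum_(i <- r | P i) F i \in Q.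
Proof. by move=> Q0 QF; elim/big_ind: _ => //; exact: Aint_idealD. Qed.

Lemma polyOver_prod_XsubC_Aint r : {in r, forall a, a \in Aint} ->
  \prod_(a <- r) ('X - a%:P) \is a polyOver Aint.
Proof.
move=> Zr; rewrite big_seq; apply: rpred_prod => a ra.
by rewrite rpredB ?polyOverX ?polyOverC ?Zr.
Qed.

(* The multiplicity of 0 as a root modulo [Q] is the index of the first
   coefficient outside [Q]. *)
Lemma count_roots_ideal r (P := \prod_(a <- r) ('X - a%:P)) :
    0 \in Q -> {in r, forall a, a \in Aint} ->
  P`_(count Q r) \notin Q /\ forall i, (i < count Q r)%N -> P`_i \in Q.
Proof.
move=> Q0; rewrite {}/P; elim: r => [|a r IHr] Zr.
  by rewrite big_nil coef1 Aint_ideal1.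
have Za : a \in Aint by apply: Zr; rewrite mem_head.
have {}Zr : {in r, forall b, b \in Aint} by move=> b rb; apply: Zr; rewrite inE rb orbT.
have [nQk Qi] := IHr Zr; have ZP := polyOver_prod_XsubC_Aint Zr.
rewrite big_cons; set P := \prod_(b <- r) _ in nQk Qi ZP *.
have ZPi i : P`_i \in Aint by exact: (polyOverP ZP).
have cE i : (('X - a%:P) * P)`_i = (if i is j.+1 then P`_j else 0) - a * P`_i.
  by rewrite mulrBl coefB coefXM coefCM; case: i.
rewrite /=; have [Qa|nQa] := boolP (a \in Q).
  rewrite -topredE /= in Qa; rewrite Qa add1n !cE; split.
    apply: contra nQk; rewrite addrC Aint_idealDl // Aint_idealNr mulrC; exact: QM.
  move=> [|i] lt_ik; rewrite cE ?add0r ?Aint_idealNr.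
    by rewrite mulrC; exact: QM.
  by rewrite Aint_idealDl ?Qi // Aint_idealNr mulrC; exact: QM.
rewrite -topredE /= in nQa; rewrite (negPf nQa) add0n.
have Qj i : (i <= count Q r)%N -> (if i is j.+1 then P`_j else 0) \in Q.
  by case: i => // i /Qi.
split=> [|i lt_ik].
  rewrite cE Aint_idealDl ?Qj // Aint_idealNr.
  by apply/negP => /(Aint_ideal_prime Qprime Za (ZPi _))[]; apply/negP.
by rewrite cE Aint_idealDl ?Qj 1?ltnW // Aint_idealNr; apply: QM; rewrite ?Qi.
Qed.

(** Both counts are the index of the first coefficient outside [Q], which depends only on the
    coefficients modulo [Q]. *)
Lemma eq_count_roots_ideal r s :
    0 \in Q -> {in r, forall a, a \in Aint} -> {in s, forall a, a \in Aint} ->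
    (forall i, (\prod_(a <- r) ('X - a%:P))`_i
             - (\prod_(a <- s) ('X - a%:P))`_i \in Q) ->
  count Q r = count Q s.
Proof.
move=> Q0 Zr Zs eq_rs.
have [nQr Qr] := count_roots_ideal Q0 Zr; have [nQs Qs] := count_roots_ideal Q0 Zs.
apply/eqP; case: ltngtP => // [/Qs | /Qr] Qk.
  by case/negP: nQr; have:= eq_rs (count Q r); rewrite addrC Aint_idealDl // Aint_idealNr.
by case/negP: nQs; have:= eq_rs (count Q s); rewrite Aint_idealDl ?Aint_idealNr.
Qed.

End RootsInIdeal.

(** * Congruences modulo a prime ideal *)

Section ModIdeal.

Variables (Q : pred algC) (Qprime : Aint_prime_ideal Q).
Hypothesis Q0 : 0 \in Q.

(** Integrality is part of the congruence because [Q] absorbs only integral factors; it makes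
    products compatible. *)
Definition poly_mod_ideal (f g : {poly algC}) : Prop :=
  [/\ f \is a polyOver Aint, g \is a polyOver Aint & forall k, (f - g)`_k \in Q].

Lemma poly_mod_idealM f g f' g' : poly_mod_ideal f g -> poly_mod_ideal f' g' ->
  poly_mod_ideal (f * f') (g * g').
Proof.
case=> Zf Zg Qfg [Zf' Zg' Qfg']; split; rewrite ?rpredM // => k.
have -> : f * f' - g * g' = (f - g) * f' + g * (f' - g').
  by rewrite mulrBl mulrBr addrA subrK.
rewrite coefD (Aint_idealD Qprime) // coefM (Aint_ideal_sum Qprime) // => i _.
  by rewrite mulrC (Aint_idealMl Qprime) // (polyOverP Zf').
by rewrite (Aint_idealMl Qprime) // (polyOverP Zg).
Qed.

Lemma poly_mod_idealD f g f' g' : poly_mod_ideal f g -> poly_mod_ideal f' g' ->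
  poly_mod_ideal (f + f') (g + g').
Proof.
case=> Zf Zg Qfg [Zf' Zg' Qfg']; split; rewrite ?rpredD // => k.
by rewrite opprD addrACA coefD (Aint_idealD Qprime).
Qed.

Lemma poly_mod_ideal_refl f : f \is a polyOver Aint -> poly_mod_ideal f f.
Proof. by move=> Zf; split=> // k; rewrite subrr coef0. Qed.

Lemma det_mod_ideal n (A B : 'M[{poly algC}]_n) :
  (forall i j, poly_mod_ideal (A i j) (B i j)) -> poly_mod_ideal (\det A) (\det B).
Proof.
move=> AB; rewrite /determinant; elim/big_ind2: _ => [|f g f' g'|s _].
- by apply: poly_mod_ideal_refl; rewrite rpred0.
- exact: poly_mod_idealD.
apply: poly_mod_idealM; first by apply: poly_mod_ideal_refl; rewrite rpred_sign.
elim/big_ind2: _ => [|f g f' g'|//]; last exact: poly_mod_idealM.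
by apply: poly_mod_ideal_refl; rewrite rpred1.
Qed.

Lemma char_poly_mod_ideal n (A B : 'M[algC]_n) :
  (forall i j, [/\ A i j \in Aint, B i j \in Aint & A i j - B i j \in Q]) ->
  forall k, (char_poly A - char_poly B)`_k \in Q.
Proof.
move=> AB; suff [_ _]: poly_mod_ideal (char_poly A) (char_poly B) by [].
apply: det_mod_ideal => i j; have [ZA ZB QAB] := AB i j.
rewrite !mxE; apply: poly_mod_idealD.
  by apply: poly_mod_ideal_refl; rewrite rpredMn ?polyOverX.
split; rewrite ?rpredN ?polyOverC // => k.
rewrite opprK addrC -polyCB coefC; case: eqP => // _.
by rewrite -opprB (Aint_idealN Qprime).
Qed.

Lemma prime_ideal_exp a n : a \in Aint -> a ^+ n \in Q -> a \in Q.
Proof.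
move=> Za; elim: n => [|n IHn]; first by rewrite expr0 (negPf (Aint_ideal1 Qprime)).
by rewrite exprS => /(Aint_ideal_prime Qprime Za (rpredX _ Za))[].
Qed.

(** In the binomial expansion of [((a - 1) + 1) ^+ q = 1] the middle terms are multiples of [q], so
    [(a - 1) ^+ q] lies in the prime ideal [Q]. *)
Lemma unity_root_mod_ideal q a : prime q -> q%:R \in Q -> a ^+ q = 1 -> a - 1 \in Q.
Proof.
move=> q_pr Qq aq1; have q_gt0 := prime_gt0 q_pr.
have Za : a \in Aint by apply: (Aint_unity_root q_gt0); apply/unity_rootP.
have Zb : a - 1 \in Aint by rewrite rpredB ?rpred1.
apply: (@prime_ideal_exp _ q) => //.
have := exprD1n (a - 1) q; rewrite subrK aq1.
rewrite -(big_mkord xpredT (fun i => (a - 1) ^+ i *+ 'C(q, i))).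
rewrite big_nat_recr //= big_ltn // expr0 bin0 binn !mulr1n -addrA.
rewrite -{1}[1]addr0 => /addrI/esym/eqP; rewrite addrC addr_eq0 => /eqP ->.
rewrite (Aint_idealN Qprime) // big_nat_cond (Aint_ideal_sum Qprime) // => i.
rewrite andbT => /(prime_dvd_bin q_pr)/dvdnP[m ->].
by rewrite -mulr_natr natrM mulrA (Aint_idealMl Qprime) // rpredM ?rpred_nat ?rpredX.
Qed.

Lemma coprime_notin_ideal m n : m%:R \in Q -> coprime m n -> n%:R \notin Q.
Proof.
move=> Qm co_mn; apply/negP => Qn.
have [m0|m_gt0] := posnP m.
  move: co_mn Qn; rewrite m0 /coprime gcd0n => /eqP ->.
  by rewrite (negPf (Aint_ideal1 Qprime)).
have [u _ /dvdnP[v]] := Bezoutl n m_gt0; rewrite (eqnP co_mn) => eq_uv.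
case/negP: (Aint_ideal1 Qprime).
have -> : 1 = v%:R * m%:R - u%:R * n%:R :> algC.
  by rewrite -!natrM -eq_uv natrD addrK.
by rewrite (Aint_idealD Qprime) ?(Aint_idealN Qprime) ?(Aint_idealMl Qprime) ?rpred_nat.
Qed.

End ModIdeal.

(** * Class sums and induced characters *)

Lemma char_poly_sim (R : fieldType) n (A B P : 'M[R]_n) :
  P \in unitmx -> A *m P = P *m B -> char_poly A = char_poly B.
Proof.
move=> uP AP; rewrite /char_poly /char_poly_mx.
have nzP : \det (map_mx polyC P) != 0.
  by rewrite det_map_mx polyC_eq0 -unitfE -unitmxE.
apply: (mulIf nzP); rewrite -det_mulmx mulmxBl mulrC -det_mulmx mulmxBr.
by rewrite -!map_mxM AP scalar_mxC.
Qed.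

Section ClassSum.

Variables (gT : finGroupType) (G : {group gT}) (x : gT).
Hypothesis Gx : x \in G.

(** The value of the central character of ['chi_i] on the class sum of [x]. *)
Definition class_mode (i : Iirr G) : algC := #|(x ^: G)%g|%:R * 'chi_i x / 'chi_i 1%g.

Lemma irr_class_sum i : \sum_(c in (x ^: G)%g) 'Chi_i c = (class_mode i)%:M.
Proof.
have clxG := mem_classes Gx; pose k := enum_rank_in clxG ((x ^: G)%g).
have Dk : enum_val k = (x ^: G)%g by rewrite enum_rankK_in.
have kx : x \in enum_val k by rewrite Dk class_refl.
rewrite /class_mode -(gring_mode_class_sum_eq i kx).
rewrite -irr_gring_center ?gring_class_sum_central // /gring_class_sum /gset_mx Dk.
rewrite raddf_sum; apply: eq_bigr => c cxG.
by rewrite [RHS]gring_opG // (subsetP (class_subG Gx (subxx G))).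
Qed.

Variable z : algC.

Let P (rG : representation algC G) :=
  char_poly (\sum_(c in (x ^: G)%g) rG c - z%:M).

Let P_dadd rG1 rG2 : P (dadd_grepr rG1 rG2) = P rG1 * P rG2.
Proof.
rewrite /P {2 3}/char_poly -(det_ublock _ 0) -char_block_diag_mx; congr char_poly.
rewrite /= (eq_bigr (fun c => block_mx (rG1 c) 0 0 (rG2 c))) //.
rewrite scalar_mx_block opp_block_mx !oppr0.
rewrite (_ : \sum_(c in _) _ = block_mx (\sum_(c in (x ^: G)%g) rG1 c) 0 0 (\sum_(c in (x ^: G)%g) rG2 c)).
  by rewrite add_block_mx !addr0.
elim: (index_enum _) => [|c r IHr]; first by rewrite !big_nil block_mx0.
rewrite !big_cons IHr; case: ifP => // _.
by rewrite add_block_mx !addr0.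
Qed.

Let P0 : P (@grepr0 _ _ G) = 1.
Proof. by rewrite /P /char_poly det_mx00. Qed.

Let P_sim (rG1 rG2 : representation _ G) : mx_rsim rG1 rG2 -> P rG1 = P rG2.
Proof.
case: rG1 rG2 => n1 rG1 [n2 rG2] [f /= Dn]; move: rG2 f; rewrite -{n2}Dn => rG2 f uf sim.
rewrite /P /=; apply: (@char_poly_sim _ _ _ _ f); first by rewrite -row_free_unit.
rewrite mulmxBl mulmxBr scalar_mxC mulmx_suml mulmx_sumr; congr (_ - _).
apply: eq_bigr => c cxG; apply: sim.
by rewrite (subsetP (class_subG Gx (subxx G))).
Qed.

(** [P] turns direct sums into products and respects similarity, so it can be computed on the
    decomposition into irreducibles, where the class sum is scalar. The shift by [z] serves to move
    a chosen root to 0. *)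
Lemma char_poly_class_sum n (rG : mx_representation algC G n) :
  char_poly (\sum_(c in (x ^: G)%g) rG c - z%:M) =
    \prod_i ('X - (class_mode i - z)%:P)
       ^+ (Num.truncn '[cfRepr rG, 'chi_i] * Num.truncn ('chi_i 1%g)).
Proof.
rewrite -[LHS]/(P (Representation rG)) (@P_sim (Representation rG) (standard_grepr rG) (mx_rsim_standard rG)).
rewrite (big_morph P P_dadd P0) (reindex _ (socle_of_Iirr_bij _)) /=.
apply: eq_bigr => i _; rewrite /muln_grepr (big_morph P P_dadd P0) prodr_const card_ord.
rewrite mulnC exprM; congr (_ ^+ _); last first.
  rewrite -[LHS](@natrK algC); congr Num.truncn.
  rewrite (cfRepr_sim (mx_rsim_standard rG)) cfRepr_standard cfdot_suml (bigD1 i) //=.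
  rewrite cfdotZl cfnorm_irr mulr1 big1 ?addr0 // => j ne_ji.
  by rewrite cfdotZl cfdot_irr (negPf ne_ji) mulr0.
rewrite /P /= irr_class_sum -raddfB /=.
rewrite irr1_degree (@natrK algC).
rewrite char_poly_trig ?scalar_mx_is_trig //.
by under eq_bigr => j _ do rewrite mxE eqxx mulr1n; rewrite prodr_const card_ord.
Qed.

End ClassSum.

(** * Monomial representations induced from linear characters *)

Section MonomialRepr.

Variables (gT : finGroupType) (G H : {group gT}).
Hypothesis sHG : H \subset G.
Variable lam : 'CF(H).
Hypothesis lin_lam : lam \is a linear_char.

Let t (i : 'I_#|rcosets H G|) : gT := repr (enum_val i).

Let rcos_t i : enum_val i = (H :* t i)%g.
Proof.
have /rcosetsP[y Gy Dy] := enum_valP i; rewrite /t Dy.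
by apply/esym/rcoset_eqP; exact: mem_repr_rcoset.
Qed.

Let Gt i : t i \in G.
Proof.
have: t i \in enum_val i by rewrite rcos_t rcoset_refl.
have /rcosetsP[y Gy ->] := enum_valP i; case/rcosetP=> h Hh ->.
by rewrite groupM // (subsetP sHG).
Qed.

Let t_inj i j : (t i * (t j)^-1)%g \in H -> i = j.
Proof. by rewrite -mem_rcoset => /rcoset_eqP eq_ij; apply: enum_val_inj; rewrite !rcos_t. Qed.

Let t_cover g : g \in G -> exists i, (g * (t i)^-1)%g \in H.
Proof.
move=> Gg; have HgG : (H :* g)%g \in rcosets H G by apply/rcosetsP; exists g.
exists (enum_rank_in HgG (H :* g)%g).
by rewrite -mem_rcoset -rcos_t enum_rankK_in // rcoset_refl.
Qed.

(** As [lam] vanishes outside [H], row [i] has a single nonzero entry, in the column of the coset of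
    [t i * g]. Another linear character changes only the values of these entries, not their
    places. *)
Definition monomial_mx (g : gT) : 'M[algC]_#|rcosets H G| :=
  \matrix_(i, j) lam (repr (enum_val i) * g * (repr (enum_val j))^-1)%g.

Lemma monomial_mx_repr : mx_repr G monomial_mx.
Proof.
split=> [|g h Gg Gh]; apply/matrixP=> i j; rewrite !mxE.
  rewrite mulg1; case: eqP => [->|ne_ij]; first by rewrite mulgV lin_char1.
  by rewrite cfun0 //; apply/negP => /t_inj.
have [k Hk] := t_cover (groupM (Gt i) Gg).
rewrite (bigD1 k) //= big1 ?addr0 => [|k' ne_k'k].
  rewrite !mxE -!/(t _); set a := (t i * g * _)%g in Hk *.
  have -> : (t i * (g * h) * (t j)^-1 = a * (t k * h * (t j)^-1))%g.
    by rewrite /a !mulgA mulgKV.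
  have [Hb|nHb] := boolP ((t k * h * (t j)^-1)%g \in H); first by rewrite lin_charM.
  by rewrite [in RHS](cfun0 _ nHb) mulr0 cfun0 // groupMl.
rewrite !mxE -!/(t _) [lam (t i * _ * _)%g]cfun0 ?mul0r //.
apply: contra ne_k'k => Hk'; apply/eqP/t_inj.
have -> : (t k' * (t k)^-1 = (t i * g * (t k')^-1)^-1 * (t i * g * (t k)^-1))%g.
  by rewrite !invMg !mulgA invgK mulgKV mulgKV.
by rewrite groupM ?groupV.
Qed.

Definition monomial_repr := MxRepresentation monomial_mx_repr.

(** After inverting the summation variable, the sum defining the induced character splits along the
    right cosets of [H]. Its terms are constant on each coset because [lam] is a class function. *)
Lemma cfRepr_monomial : cfRepr monomial_repr = 'Ind[G] lam.
Proof.
apply/cfun_inP => g Gg; rewrite cfunE Gg cfIndE //.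
apply: (canRL (mulKf (neq0CG H))).
rewrite (reindex_inj invg_inj) /= (eq_bigl [in G]) => [|y]; last by rewrite groupV.
rewrite (set_partition_big _ (rcosets_partition sHG)) /= big_enum_val mulr_sumr /=.
apply: eq_bigr => i _; rewrite mxE -!/(t i) rcos_t.
transitivity (\sum_(y in (H :* t i)%g) lam (t i * g * (t i)^-1)%g).
  by rewrite sumr_const card_rcoset mulr_natl.
apply: eq_bigr => _ /rcosetP[h Hh ->].
rewrite conjgE invgK invMg !mulgA -(mulgA _ _ h^-1%g).
rewrite -[in RHS](cfunJ _ _ Hh) conjgE; congr (lam _).
by rewrite !mulgA mulVg mul1g mulgKV.
Qed.

End MonomialRepr.

(** * Groups generated by a class of prime power size *)

Section PrimePowerClass.

Variables (gT : finGroupType) (G : {group gT}) (x : gT) (p : nat).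
Hypotheses (Gx : x \in G) (p_pr : prime p).

Let N := #|(x ^: G)%g|.

Section Block.

Variables (Q : pred algC) (Qprime : Aint_prime_ideal Q) (q : nat).
Hypotheses (q_pr : prime q) (Qq : q%:R \in Q).

Let Q0 : 0 \in Q. Proof. exact: Aint_ideal0 Qprime _ Qq. Qed.

Definition class_block (i : Iirr G) : bool := (class_mode x i - N%:R) \in Q.

Let Aint_mode (i : Iirr G) : class_mode x i - N%:R \in Aint.
Proof. by rewrite rpredB ?rpred_nat ?Aint_class_div_irr1. Qed.

Let Cnat_truncn (a : algC) : a \in Num.nat -> a = (Num.truncn a)%:R.
Proof. by move/truncnK. Qed.

Section MultiplicityCount.

Variable H : {group gT}.
Hypotheses (sHG : H \subset G) (qH : #|H| = q).

(** The eigenvalues, with multiplicity, of the class sum minus [N] in the representation induced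
    from [lam]. *)
Let roots (lam : 'CF(H)) : seq algC :=
  flatten [seq nseq (Num.truncn '['Ind[G] lam, 'chi_i] * Num.truncn ('chi_i 1%g))
                    (class_mode x i - N%:R) | i <- index_enum (Iirr G)].

Let count_roots lam : lam \is a linear_char ->
  (count Q (roots lam))%:R =
    '[lam, 'Res[H] (\sum_(i | class_block i) 'chi_i 1%g *: 'chi_i)].
Proof.
move=> lin_lam; rewrite Frobenius_reciprocity count_flatten sumnE !big_map /=.
rewrite natr_sum cfdot_sumr [RHS]big_mkcond; apply: eq_bigr => i _.
rewrite count_nseq /class_block -topredE /=; case: ifP => _; last by rewrite mul0n.
rewrite mul1n natrM -!Cnat_truncn ?Cnat_irr1 ?Cnat_cfdot_char_irr ?cfInd_char ?lin_charW //.
by rewrite cfdotZr mulrC (@conj_natr algC) ?Cnat_irr1.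
Qed.

Let prod_roots lam (lin_lam : lam \is a linear_char) :
  \prod_(a <- roots lam) ('X - a%:P) =
    char_poly (\sum_(c in (x ^: G)%g) monomial_mx G lam c - N%:R%:M).
Proof.
rewrite (char_poly_class_sum Gx N%:R (monomial_repr sHG lin_lam)) cfRepr_monomial.
rewrite big_flatten big_map; apply: eq_bigr => i _ /=.
by rewrite big_nseq iter_mulr_1.
Qed.

Lemma linear_mod_ideal (lam : 'CF(H)) h : lam \is a linear_char -> h \in H ->
  lam h - 1 \in Q.
Proof.
move=> lin_lam Hh; apply: (unity_root_mod_ideal Qprime Q0 q_pr Qq).
by rewrite -lin_charX // -qH expg_cardG // lin_char1.
Qed.

(** Values of linear characters of [H] are [q]-th roots of unity, hence 1 modulo [Q]. The two
    induced matrices therefore agree modulo [Q] and have equally many eigenvalues in [Q]; by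
    Frobenius reciprocity these numbers are the two inner products. *)
Lemma linear_mult_block (lam mu : 'CF(H)) (phi := \sum_(i | class_block i) 'chi_i 1%g *: 'chi_i) :
    lam \is a linear_char -> mu \is a linear_char ->
  '[lam, 'Res[H] phi] = '[mu, 'Res[H] phi].
Proof.
move=> lin_lam lin_mu; rewrite -!count_roots //; congr _%:R.
have Aroots nu : {in roots nu, forall a, a \in Aint}.
  by move=> a /flattenP[_ /mapP[i _ ->]]; rewrite mem_nseq => /andP[_ /eqP->]; exact: Aint_mode.
apply: (eq_count_roots_ideal Qprime) => // i.
rewrite !prod_roots // -coefB; apply: (char_poly_mod_ideal Qprime Q0) => // j k.
have Aent nu : nu \is a linear_char ->
    (\sum_(c in (x ^: G)%g) monomial_mx G nu c - N%:R%:M) j k \in Aint.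
  move=> lin_nu; rewrite !mxE summxE rpredB ?rpredMn ?rpred_nat // rpred_sum // => c _.
  by rewrite mxE Aint_char ?lin_charW.
split; rewrite ?Aent // !mxE !summxE opprB addrA subrK -sumrB.
apply: (Aint_ideal_sum Qprime) => // c _; rewrite !mxE; set h := (_ * _)%g.
have [Hh|nHh] := boolP (h \in H); last by rewrite !cfun0 ?subr0.
rewrite -[lam h](subrK 1) -addrA (Aint_idealD Qprime) ?linear_mod_ideal //.
by rewrite -opprB (Aint_idealN Qprime) ?linear_mod_ideal.
Qed.

End MultiplicityCount.

(* The block sum restricts to a multiple of the regular character of [<[y]>]. *)
Lemma block_sum_vanish y : y \in G -> #[y]%g = q ->
  \sum_(i | class_block i) 'chi[G]_i 1%g * 'chi_i y = 0.
Proof.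
move=> Gy oy; set phi := \sum_(i | class_block i) 'chi_i 1%g *: 'chi_i.
have sHG : <[y]>%G \subset G by rewrite cycle_subG.
have Hy : y \in <[y]>%G by exact: cycle_id.
have lin_H (i : Iirr <[y]>%G) : 'chi_i \is a linear_char by rewrite irr_cyclic_lin ?cycle_cyclic.
have -> : \sum_(i | class_block i) 'chi_i 1%g * 'chi_i y = 'Res[<[y]>%G] phi y.
  by rewrite cfResE // sum_cfunE; apply: eq_bigr => i _; rewrite cfunE.
suffices -> : 'Res[<[y]>%G] phi = '['Res[<[y]>%G] phi, 1] *: cfReg <[y]>%G.
  rewrite cfunE cfRegE; case: eqP oy => [->|_ _]; last by rewrite mulr0.
  by rewrite order1 => q1; move: q_pr; rewrite -q1.
rewrite [LHS]cfun_sum_cfdot cfReg_sum scaler_sumr; apply: eq_bigr => i _.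
rewrite scalerA lin_char1 // mulr1; congr (_ *: _).
by rewrite cfdotC (linear_mult_block sHG oy (lin_H i) (cfun1_lin_char _)) -cfdotC.
Qed.

End Block.

Hypotheses (pN : p.-nat N) (genG : <<(x ^: G)%g>>%g = G).

Section BlockPrime.

Variables (Q : pred algC) (Qprime : Aint_prime_ideal Q) (q : nat).
Hypotheses (q_pr : prime q) (Qq : q%:R \in Q) (ne_qp : q != p).

Let notQp : p%:R \notin Q.
Proof.
by rewrite (coprime_notin_ideal Qprime Qq) // prime_coprime // dvdn_prime2.
Qed.

Let notQN : N%:R \notin Q.
Proof.
rewrite (coprime_notin_ideal Qprime Qq) // prime_coprime // -p'natE //.
by apply: sub_in_pnat pN => r _ /eqnP ->; rewrite inE /= inE eq_sym.
Qed.

(** If [p] does not divide the degree, Burnside's lemma gives ['chi_i x = 0] or [x] in the center of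
    ['chi_i]. The first would put [N] in [Q]. In the second case the center, being normal, is all of
    [G], so the degree is 1. *)
Lemma nonlinear_block_dvd (i : Iirr G) : class_block Q i -> 'chi_i \isn't a linear_char ->
  (p %| Num.truncn ('chi_i 1%g))%N.
Proof.
move=> Bi nlin; apply: contraR nlin => p'chi1.
have Zx : x \in ('Z('chi_i))%CF.
  apply: contraT => notZx; case/negP: notQN; move: Bi; rewrite /class_block /class_mode.
  rewrite (coprime_degree_support_cfcenter _ notZx) ?mulr0 ?mul0r ?sub0r ?(Aint_idealNr Qprime) //.
  by rewrite coprime_sym (pnat_coprime pN) // p'natE.
have ZG : 'Z('chi_i)%CF = G.
  apply/eqP; rewrite eqEsubset cfcenter_sub -{1}genG gen_subG class_sub_norm //.
  exact: normal_norm (cfcenter_normal _).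
rewrite qualifE /= irr_char /=.
have [le1 _] := irr1_bound i; move: le1; rewrite ZG indexgg.
rewrite irr1_degree -natrX !ler_nat => le1; rewrite (eqr_nat algC _ 1).
by rewrite eqn_leq irr_degree_gt0 andbT -(leq_exp2r _ _ (ltn0Sn 1)) exp1n.
Qed.

Lemma linear_blockE (i : Iirr G) : 'chi_i \is a linear_char ->
  class_block Q i = ('chi_i x - 1 \in Q).
Proof.
move=> lin_i; rewrite /class_block /class_mode lin_char1 // divr1 -[X in _ - X]mulr1 -mulrBr.
have Zi : 'chi_i x - 1 \in Aint by rewrite rpredB ?rpred1 ?Aint_irr.
apply/idP/idP => [/(Aint_ideal_prime Qprime (rpred_nat _ _) Zi)[]|] //.
  by rewrite (negPf notQN).
by apply: (Aint_idealMl Qprime); rewrite rpred_nat.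
Qed.

(** These characters correspond to a group [M]. An element of order [p] in [M] would take at [x] a
    value [a] with [a ^+ p = 1], and [a != 1] because the class of [x] generates [G]. Then
    [1 + a + ... + a ^+ (p - 1) = 0], while each term is 1 modulo [Q], so [p] would lie in [Q]. *)
Lemma linear_block_card : ~~ (p %| #|[pred i | class_block Q i & 'chi[G]_i \is a linear_char]|)%N.
Proof.
have [L [h [injh _ Lh h_onto]] [h1 hM hX _ o_h]] := lin_char_group G.
have Q0 : 0 \in Q := Aint_ideal0 Qprime Qq.
pose M := [set u | h u x - 1 \in Q].
have gM : group_set M.
  apply/group_setP; split=> [|u v]; first by rewrite inE h1 cfun1E Gx subrr.
  rewrite !inE => Qu Qv; rewrite hM cfunE.
  have -> : h u x * h v x - 1 = h u x * (h v x - 1) + (h u x - 1).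
    by rewrite mulrBr mulr1 addrA subrK.
  by rewrite (Aint_idealD Qprime) ?(Aint_idealMl Qprime) ?Aint_char ?lin_charW.
have -> : #|[pred i | class_block Q i & 'chi[G]_i \is a linear_char]| = #|M|.
  pose f u := cfIirr (h u).
  have hE u : 'chi_(f u) = h u by rewrite cfIirrE ?lin_char_irr.
  have injf : injective f by move=> u v eq_f; apply: injh; rewrite -!hE eq_f.
  rewrite -(card_imset _ injf); apply: eq_card => i; rewrite !inE.
  apply/andP/imsetP => [[Bi lin_i] | [u Mu ->]].
    have [u Du] := h_onto _ lin_i; exists u; last by rewrite /f -Du irrK.
    by rewrite inE -Du -linear_blockE.
  have lin_u : 'chi_(f u) \is a linear_char by rewrite hE.
  by rewrite linear_blockE // hE; move: Mu; rewrite inE.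
apply/negP => /(Cauchy p_pr (G := Group gM))[u]; rewrite inE => Qu ou.
pose a := h u x.
have ap1 : a ^+ p = 1 by rewrite -exp_cfunE // -hX -ou expg_order h1 cfun1E Gx.
have [a1|ne_a1] := eqVneq a 1.
  have hu1 : h u = 1.
    have sker : G \subset cfker (h u).
      rewrite -{1}genG gen_subG class_sub_norm ?normal_norm ?cfker_normal //.
      by rewrite /= cfkerEchar ?lin_charW // inE Gx -/a a1 lin_char1 /=.
    apply/cfun_inP => g Gg; rewrite cfun1E Gg -(lin_char1 (Lh u)).
    by apply: cfker1; exact: (subsetP sker).
  have u1 : u = 1%g by apply: injh; rewrite h1.
  by move: p_pr; rewrite -ou u1 order1.
have p_gt0 := prime_gt0 p_pr.
have sum0 : \sum_(i < p) a ^+ i = 0.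
  have := subrX1 a p; rewrite ap1 subrr => /esym/eqP; rewrite mulf_eq0 subr_eq0 (negPf ne_a1).
  by move/eqP.
have Za : a \in Aint by rewrite Aint_char ?lin_charW.
have Qpow i : a ^+ i - 1 \in Q.
  by rewrite subrX1 mulrC (Aint_idealMl Qprime) // rpred_sum // => j _; rewrite rpredX.
case/negP: notQp; rewrite -(Aint_idealNr Qprime) -[- _]add0r -sum0.
rewrite -[p in p%:R]card_ord -sumr_const -sumrB.
exact: (Aint_ideal_sum Qprime).
Qed.

End BlockPrime.

Theorem prime_power_class_der1_pgroup : (p.-group G^`(1))%g.
Proof.
apply/pgroupP => q q_pr q_dv; rewrite inE /=; apply: contraT => ne_qp.
have [y G'y oy] := Cauchy q_pr q_dv.
have Gy : y \in G := subsetP (der_sub 1 G) y G'y.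
have [Q Qprime Qq] := Aint_prime_ideal_over (prime_gt1 q_pr).
case/negP: (linear_block_card Qprime q_pr Qq ne_qp).
have := block_sum_vanish Qprime q_pr Qq Gy oy.
(* At [y] in [G'] each linear character contributes 1, and each nonlinear one an integral multiple
   of [p]. *)
rewrite (bigID (fun i => 'chi_i \is a linear_char)) /=.
rewrite (eq_bigr (fun _ => 1)) => [|i /andP[_ lin_i]]; last first.
  rewrite lin_char1 // mul1r -(lin_char1 lin_i); apply: cfker1.
  by apply: subsetP G'y; exact: lin_char_der1.
rewrite sumr_const => /eqP; rewrite addr_eq0 => /eqP eqL.
rewrite -eqAmod0_nat eqAmod0; apply: etrans (congr1 (fun a => a \in dvdA p%:R) eqL) _.
rewrite rpredN rpred_sum // => i /andP[Bi nlin_i].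
have /dvdnP[m Dm] := nonlinear_block_dvd Qprime q_pr Qq ne_qp Bi nlin_i.
rewrite -['chi_i 1%g]truncnK ?Cnat_irr1 // Dm natrM mulrAC -eqAmod0 eqAmodMl0 //.
by rewrite rpredM ?rpred_nat ?Aint_irr.
Qed.

End PrimePowerClass.

Local Open Scope group_scope.

(** * Fixed points of the generator on the derived subgroup *)

Section ClassGenerated.

Variables (gT : finGroupType) (G : {group gT}) (x : gT).
Hypothesis Gx : x \in G.

(** Each generator [x ^ g = x * [~ x, g]] lies in [<[x]> * G']. *)
Lemma class_gen_der1_cycle : <<x ^: G>> = G -> <[x]> * G^`(1) = G.
Proof.
move=> genG; have nG'x : <[x]> \subset 'N(G^`(1)).
  by rewrite cycle_subG (subsetP (der_norm 1 G)).
rewrite -norm_joinEl //; apply/eqP; rewrite eqEsubset join_subG cycle_subG Gx der_sub /=.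
rewrite -{1}genG gen_subG; apply/subsetP => _ /imsetP[g Gg ->].
rewrite conjg_mulR groupM //; first by rewrite (subsetP (joing_subl _ _)) ?cycle_id.
by rewrite (subsetP (joing_subr _ _)) // mem_commg.
Qed.

(* Modulo the image of [a |-> [a, x]] the group is abelian, so this endomorphism
   of [G'] is onto, hence injective. *)
Lemma cent1_abelian_der1 : <[x]> * G^`(1) = G -> abelian G^`(1) -> 'C_(G^`(1))[x] = 1.
Proof.
set A := (G^`(1))%G => defG abA; pose f a := a^-1 * a ^ x.
have nAx : x \in 'N(A) by rewrite (subsetP (der_norm 1 G)).
have cA : {in A &, forall a b, commute a b} by move=> a b Aa Ab; exact: (centsP abA).
have Ax a : a \in A -> a ^ x \in A by move=> Aa; rewrite memJ_norm.
have Af a : a \in A -> f a \in A.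
  by move=> Aa; apply: groupM; [rewrite groupV | apply: Ax].
have fM : {in A &, {morph f : a b / a * b}}.
  move=> a b Aa Ab; rewrite /f invMg conjMg.
  have -> : b^-1 * a^-1 * (a ^ x * b ^ x) = b^-1 * (a^-1 * a ^ x) * b ^ x by rewrite !mulgA.
  by rewrite (cA b^-1 (f a)) ?Af ?groupV // /f !mulgA.
pose fm := Morphism fM.
have sBA : fm @* A \subset A.
  by apply/subsetP=> _ /morphimP[a Aa _ ->]; apply: Af.
have nBx : <[x]> \subset 'N(fm @* A).
  rewrite cycle_subG inE; apply/subsetP => _ /imsetP[_ /morphimP[a Aa _ ->] ->].
  by rewrite /= conjMg conjVg; apply/morphimP; exists (a ^ x); rewrite ?Ax.
have nBA : A \subset 'N(fm @* A) by apply: sub_abelian_norm.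
have sAB : A \subset fm @* A.
  apply: der1_min; first by rewrite -defG mul_subG.
  rewrite -defG quotientMl // abelianM !quotient_abelian ?cycle_abelian //=.
  rewrite quotient_cents2r // gen_subG.
  apply/subsetP => _ /imset2P[a _ Aa /cycleP[i ->] ->].
  elim: i => [|i IHi]; first by rewrite expg0 commg1 group1.
  have Bax b : b \in A -> [~ b, x] \in fm @* A.
    by move=> Ab; apply/morphimP; exists b; rewrite // commgEl.
  rewrite expgS commgMJ groupM // memJ_norm ?Bax //.
  by rewrite (subsetP nBx) ?mem_cycle.
have injf : 'injm fm.
  by rewrite -card_im_injm eqn_leq leq_morphim subset_leq_card.
apply/trivgP/subsetP => a /setIP[Aa /cent1P cax].
rewrite -(trivgP injf); apply/kerP => //.
by rewrite /= /f conjgE cax mulKg mulVg.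
Qed.

End ClassGenerated.

(** A smaller index would be 1 or [p], making [N / N'] cyclic; a nilpotent group with cyclic
    abelianization is cyclic. *)
Lemma nonabelian_pgroup_der1_index (gT : finGroupType) (N : {group gT}) p :
  prime p -> p.-group N -> ~~ abelian N -> (p ^ 2 <= #|N : N^`(1)|)%N.
Proof.
move=> p_pr pN; apply: contraR; rewrite -ltnNge => lt_p2.
apply/cyclic_abelian/cyclic_nilpotent_quo_der1_cyclic; first exact: pgroup_nil pN.
rewrite -card_quotient ?der_norm // in lt_p2.
have /p_natP[k Dk] : p.-nat #|N / N^`(1)| by exact: quotient_pgroup.
case: k Dk => [|[|k]] Dk.
- by rewrite (card1_trivg Dk) cyclic1.
- by apply: prime_cyclic; rewrite Dk expn1.
by move: lt_p2; rewrite Dk ltn_exp2l ?prime_gt1.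
Qed.

Section PGroupDer1.

Variables (gT : finGroupType) (G : {group gT}) (x : gT) (p : nat).
Hypotheses (Gx : x \in G) (p_pr : prime p).
Hypotheses (genG : <<x ^: G>> = G) (pG' : p.-group G^`(1)).

(** The quotient [G / G''] has abelian derived subgroup, so [cent1_abelian_der1] applies to it. *)
Lemma cent1_der1_sub : 'C_(G^`(1))[x] \subset G^`(2).
Proof.
have nMG : G \subset 'N(G^`(2)) := der_norm 2 G.
have nMx : x \in 'N(G^`(2)) by rewrite (subsetP nMG).
have der_q : (G / G^`(2))^`(1) = G^`(1) / G^`(2) by rewrite -quotient_der.
have Gqx : coset G^`(2) x \in G / G^`(2) by rewrite mem_quotient.
have genq : <<coset G^`(2) x ^: (G / G^`(2))>> = G / G^`(2).
  by rewrite -quotient_class // -quotient_gen ?genG ?(subset_trans (class_subG Gx (subxx G))).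
have := cent1_abelian_der1 Gqx (class_gen_der1_cycle Gqx genq).
rewrite der_q => /(_ (der_abelian 1 G)) tr.
apply/subsetP=> h /setIP[G'h /cent1P cxh].
have nMh : h \in 'N(G^`(2)) by rewrite (subsetP nMG) // (subsetP (der_sub 1 G)).
apply: coset_idr => //; apply/set1gP; rewrite -tr inE mem_quotient //=.
by apply/cent1P; rewrite /commute -!morphM // cxh.
Qed.

(** If [G'] were nonabelian, then [p ^ 2 <= #|G' : G''|]. Since ['C_(G')[x]] lies in [G''] and has
    index at most [#|x ^: G| <= p ^ 2], all these are equalities. Then [G''] centralizes [x], hence
    its class and [G], so [G''] lies in the trivial group ['Z(G)]. *)
Lemma small_class_abelian_der1 : (#|x ^: G| <= p ^ 2)%N ->
  (#|x ^: G| = (p ^ 2)%N -> 'Z(G) = 1) -> abelian G^`(1) /\ 'C_(G^`(1))[x] = 1.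
Proof.
move=> le_p2 ZG1.
have abN : abelian G^`(1).
  apply: contraT => nab; have le1 := nonabelian_pgroup_der1_index p_pr pG' nab.
  have le2 : (#|G^`(1) : 'C_(G^`(1))[x]| <= #|x ^: G|)%N.
    rewrite index_cent1 subset_leq_card //; apply/subsetP => _ /imsetP[g G'g ->].
    by rewrite memJ_class // (subsetP (der_sub 1 G)).
  have p2_gt0 : (0 < p ^ 2)%N by rewrite expn_gt0 prime_gt0.
  have eqC : 'C_(G^`(1))[x] = G^`(2).
    apply/eqP; rewrite eqEcard cent1_der1_sub -(leq_pmul2r (m := p ^ 2)) //.
    apply: leq_trans (_ : #|G^`(2)| * #|G^`(1) : G^`(2)| <= _)%N; first by rewrite leq_mul2l le1 orbT.
    rewrite Lagrange ?(der_sub 1 (G^`(1))%G) //.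
    have := Lagrange (subsetIl G^`(1) 'C[x]) => /= {1}<-.
    by rewrite leq_mul2l (leq_trans le2) ?orbT.
  have ZG : 'Z(G) = 1.
    by apply: ZG1; apply/eqP; rewrite eqn_leq le_p2 (leq_trans le1) //; move: le2; rewrite eqC.
  have : G^`(2) \subset 'Z(G).
    rewrite subsetI der_sub /= centsC -{1}genG gen_subG class_sub_norm; last first.
      exact: norms_cent (der_norm 2 G).
    by apply/centP => h; rewrite -eqC => /setIP[_ /cent1P].
  by rewrite ZG => /trivgP G''1; case/negP: nab; apply/commG1P.
by split=> //; apply: cent1_abelian_der1 => //; exact: class_gen_der1_cycle.
Qed.

End PGroupDer1.

(** * The inner group of an indecomposable rack *)

Section InnerGroup.

Variables (X : finType) (op : X -> X -> X).
Hypothesis rackX : is_rack op.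

Definition rack_perm x : {perm X} := perm (bij_inj (rackX.1 x)).

Lemma rack_permE x y : rack_perm x y = op x y.
Proof. by rewrite permE. Qed.

Definition inner_group : {group {perm X}} := generated_group (rack_perm @: [set: X]).

Let G := inner_group.

Lemma mem_rack_perm x : rack_perm x \in G.
Proof. by rewrite mem_gen // imset_f ?inE. Qed.

(** For a left translation [g] this is self-distributivity; in general [g] is a product of left
    translations. *)
Lemma rack_permJ x g : g \in G -> rack_perm (g x) = rack_perm x ^ g.
Proof.
have step y z : rack_perm (rack_perm y z) = rack_perm z ^ rack_perm y.
  apply/permP => w; rewrite -(permKV (rack_perm y) w); set v := (rack_perm y)^-1 w.
  by rewrite permJ !rack_permE (rackX.2 y z v).
have stepV y z : rack_perm ((rack_perm y)^-1 z) = rack_perm z ^ (rack_perm y)^-1.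
  by rewrite -{2}(permKV (rack_perm y) z) step conjgK.
move=> /gen_prodgP[n [c Gc ->]]; elim: n c Gc x => [|n IHn] c Gc x.
  by rewrite big_ord0 perm1 conjg1.
rewrite big_ord_recl permM conjgM IHn => [|i]; last exact: Gc.
by congr (_ ^ _); have /imsetP[y _ ->] := Gc ord0.
Qed.

Hypothesis indecX : indecomposable op.

(** The orbit of [x] and its complement are both stable under left translations, so a nonempty
    complement would decompose [X]. *)
Lemma indecomposable_transitive x y : exists2 g, g \in G & y = g x.
Proof.
pose Y := orbit 'P G x.
have stab (Z : {set X}) : (forall u z, (op u z \in Z) = (z \in Z)) ->
    [set op u z | u in [set: X], z in Z] = Z.
  move=> opZ; apply/setP => w; apply/imset2P/idP => [[u z _ Zz ->]|Zw].
    by rewrite opZ.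
  exists x ((rack_perm x)^-1 w); rewrite ?inE //; last by rewrite -rack_permE permKV.
  by rewrite -(opZ x) -rack_permE permKV.
have opY u z : (op u z \in Y) = (z \in Y).
  by rewrite -rack_permE -[_ z]/('P%act z (rack_perm u)) orbit_actr // mem_rack_perm.
have YT : Y = setT.
  apply/eqP/negPn/negP => nYT; case: indecX; exists Y, (~: Y); split; last first.
    by split; apply: stab => // u z; rewrite !inE opY.
  split; last by rewrite setUCr.
  - by apply/set0Pn; exists x; exact: orbit_refl.
  - by apply: contraNneq nYT => C0; rewrite -[Y]setCK C0 setC0.
  - by rewrite -setI_eq0 setICr.
have : y \in Y by rewrite YT inE.
by case/orbitP => g Gg <-; exists g.
Qed.

Lemma rack_perm_class x : rack_perm @: [set: X] = rack_perm x ^: G.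
Proof.
apply/setP => h; apply/imsetP/imsetP => [[y _ ->]|[g Gg ->]].
  by have [g Gg ->] := indecomposable_transitive x y; exists g; rewrite ?rack_permJ.
by exists (g x); rewrite ?inE ?rack_permJ.
Qed.

Lemma rack_perm_class_gen x : <<rack_perm x ^: G>> = G.
Proof. by rewrite -rack_perm_class. Qed.

(** By [rack_permJ] the stabilizer of [x] centralizes [rack_perm x], so the index of the centralizer
    divides the size of the orbit [X]. *)
Lemma rack_perm_class_dvd x : (#|rack_perm x ^: G| %| #|X|)%N.
Proof.
have trX : orbit 'P G x = setT.
  apply/setP => y; rewrite inE; have [g Gg ->] := indecomposable_transitive x y.
  exact: mem_orbit.
rewrite -index_cent1 -[#|X|]cardsT -trX card_orbit indexgS //.
apply/subsetP => g /setIP[Gg /astab1P gx]; rewrite inE Gg; apply/cent1P.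
have := rack_permJ x Gg; rewrite -[g x]/('P%act x g) gx => e.
by rewrite /commute {1}e conjgE mulKVg.
Qed.

(** Equality of sizes makes [rack_perm] injective; a central [z] satisfies
    [rack_perm (z y) = rack_perm y] and so fixes every [y]. *)
Lemma rack_perm_inj_center1 x : #|rack_perm x ^: G| = #|X| -> 'Z(G) = 1.
Proof.
move=> cardC; have injphi : injective rack_perm.
  have /imset_injP inj : #|rack_perm @: [set: X]| == #|[set: X]|.
    by rewrite (rack_perm_class x) cardC cardsT.
  by move=> y z; apply: inj; rewrite inE.
apply/trivgP/subsetP => z /setIP[Gz /centP cz]; apply/set1gP/permP => y; rewrite perm1.
apply: injphi; rewrite rack_permJ // conjgE.
by rewrite -(cz _ (mem_rack_perm y)) mulKg.
Qed.

Variable p : nat.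
Hypotheses (p_pr : prime p) (cardX : #|X| = (p ^ 2)%N).

(** Transitivity and [G = <[s]> * N] write every point as [g n k = (s ^+ k * n) x0], with left
    translation [s ^ n]. As ['C_N[s] = 1], this translation determines [n]. The number [m] is the
    length of the cycle of [s] through [x0]. *)
Theorem indecomposable_rack_structure :
  exists (gT : finGroupType) (N : {group gT}) (s : gT) (m : nat) (g : gT -> nat -> X),
  [/\ abelian N, s \in 'N(N), 'C_N[s] = 1, (#|N| * m = p ^ 2)%N &
   [/\ {in N &, forall n n' k k', op (g n k) (g n' k') = g ((n' * n^-1) ^ s * n) k'.+1},
      {in N, forall n k, g n (k + m) = g n k}%N
    & forall y, exists2 n, n \in N & exists k, y = g n k]].
Proof.
have /card_gt0P[x0 _] : (0 < #|X|)%N by rewrite cardX expn_gt0 prime_gt0.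
pose s := rack_perm x0; have Gs : s \in G := mem_rack_perm x0.
have genG := rack_perm_class_gen x0; rewrite -/s in genG.
have dvC := rack_perm_class_dvd x0; rewrite -/s cardX in dvC.
have pC : p.-nat #|s ^: G| by apply: pnat_dvd dvC _; rewrite pnatX pnat_id.
have pN := prime_power_class_der1_pgroup Gs p_pr pC genG.
have [||abN regs] := small_class_abelian_der1 Gs p_pr genG pN.
- by rewrite dvdn_leq // expn_gt0 prime_gt0.
- by rewrite -cardX; exact: rack_perm_inj_center1.
set N := G^`(1)%G in pN abN regs.
have sNG : N \subset G := der_sub 1 G.
have defG := class_gen_der1_cycle Gs genG.
have regN n n' : n \in N -> n' \in N -> s ^ n = s ^ n' -> n = n'.
  move=> Nn Nn' eq_s; apply/eqP; rewrite eq_mulgV1 -in_set1 -set1gE -regs.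
  rewrite inE groupM ?groupV //=; apply/cent1P/commute_sym/commgP/conjg_fixP.
  by rewrite conjgM eq_s conjgK.
pose g (n : {perm X}) k := (s ^+ k * n) x0.
have gE n k : n \in N -> rack_perm (g n k) = s ^ n.
  move=> Nn; have Gn := subsetP sNG n Nn.
  rewrite /g rack_permJ ?groupM ?groupX // -/s conjgM.
  by congr (_ ^ n); rewrite conjgE (commuteX k (commute_refl s)) mulKg.
have g_onto y : exists2 n, n \in N & exists k, y = g n k.
  have [h Gh ->] := indecomposable_transitive x0 y.
  move: Gh; rewrite -defG => /mulsgP[_ n /cycleP[k ->] Nn ->].
  by exists n => //; exists k.
pose m := #|porbit s x0|.
have sm : (s ^+ m) x0 = x0 by rewrite permX iter_porbit.
exists _, N, s, m, g; split=> //.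
- by rewrite (subsetP (der_norm 1 G)).
- rewrite -cardX -cardsT /m -cardsX; pose f (u : {perm X} * X) := u.1 u.2.
  have injf : {in setX N (porbit s x0) &, injective f}.
    move=> [n y] [n' y'] /setXP[/= Nn /porbitP[k ->]] /setXP[/= Nn' /porbitP[k' ->]].
    rewrite /f /= -!permM -/(g n k) -/(g n' k') => eq_g.
    have eq_n : n = n' by apply: regN => //; rewrite -(gE n k) // eq_g gE.
    by move: eq_g; rewrite /g eq_n !permM => /perm_inj ->.
  rewrite -(card_in_imset injf); apply: eq_card => y; rewrite inE.
  have [n Nn [k ->]] := g_onto y; apply/imsetP; exists (n, (s ^+ k) x0); last by rewrite /g permM.
  by rewrite inE /= Nn mem_porbit.
split=> // [n n' Nn Nn' k k'|n Nn k].
  rewrite -rack_permE gE // /g -permM; congr (_ x0).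
  by rewrite expgSr !conjgE !mulgA !(mulgKV, mulgK).
by rewrite /g addnC expgD -mulgA permM sm.
Qed.

End InnerGroup.

Local Close Scope group_scope.

(** * Quadratic polynomials over the prime field *)

Section Quadratic.

Import Pdiv.CommonRing Pdiv.RingMonic Pdiv.Field.

(** The class of ['X] in the finite field of polynomials modulo [h] is fixed by raising to the order
    of that field. *)
Lemma irreducible_dvd_genPoly (F : finFieldType) (h : {poly F}) :
  monic_irreducible_poly h -> h %| 'X^(#|F| ^ (size h).-1) - 'X.
Proof.
move=> hI; have [irr_h mon_h] := hI.
have mkE : mk_monic h = h := mk_monicE hI.
suff: in_qpoly h ('X^(#|F| ^ (size h).-1) - 'X) = 0.
  by move=> /val_eqP /=; rewrite mkE -Pdiv.IdomainMonic.modpE.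
pose z : {poly %/ h with hI} := in_qpoly h 'X.
have := expf_card z; rewrite card_qfpoly => zE.
by rewrite rmorphB rmorphXn /=; apply/eqP; rewrite subr_eq0; apply/eqP.
Qed.

(** Without roots [h] is irreducible, hence divides ['X^(p ^ 2) - 'X], which splits over [F]. *)
Lemma quadratic_root_or_ext (p : nat) (F : finFieldType) (f : {rmorphism 'F_p -> F}) (h : {poly 'F_p}) :
  prime p -> #|F| = (p ^ 2)%N -> h \is monic -> size h = 3%N ->
  (forall a, ~~ root h a) -> exists a : F, root (map_poly f h) a.
Proof.
move=> p_pr cardF mon_h size_h noroot.
have hI : monic_irreducible_poly h by split=> //; apply: cubic_irreducible; rewrite ?size_h.
have := irreducible_dvd_genPoly hI; rewrite size_h card_Fp // -cardF -(dvdp_map f).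
rewrite rmorphB /= map_polyXn map_polyX finField_genPoly => /dvdp_prod_XsubC[m].
set s := mask _ _ => eq_s.
have : size (map_poly f h) = (size s).+1.
  by rewrite (eqp_size eq_s) size_prod_XsubC.
rewrite size_map_poly size_h; case: s eq_s => [|a s] // eq_s _.
by exists a; rewrite (eqp_root eq_s) root_prod_XsubC mem_head.
Qed.

End Quadratic.

(** * Affine racks of order p^2 *)

Lemma rack_iso_refl (X : finType) (op : X -> X -> X) : rack_iso op op.
Proof. by exists id; split=> //; exists id. Qed.

Lemma rack_iso_sym (X Y : finType) (opX : X -> X -> X) (opY : Y -> Y -> Y) :
  rack_iso opX opY -> rack_iso opY opX.
Proof.
case=> f [[g fK gK] fM]; exists g; split; first by exists f.
by move=> x y; rewrite -{1}(gK x) -{1}(gK y) -fM fK.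
Qed.

Lemma rack_iso_trans (X Y Z : finType) (opX : X -> X -> X) (opY : Y -> Y -> Y) (opZ : Z -> Z -> Z) :
  rack_iso opX opY -> rack_iso opY opZ -> rack_iso opX opZ.
Proof.
case=> f [bij_f fM] [g [bij_g gM]]; exists (g \o f); split; first exact: bij_comp.
by move=> x y /=; rewrite fM gM.
Qed.

Lemma surj_rack_iso (X Y : finType) (opX : X -> X -> X) (opY : Y -> Y -> Y) (f : Y -> X) :
    #|X| = #|Y| -> (forall x, exists y, x = f y) ->
    (forall x y, f (opY x y) = opX (f x) (f y)) ->
  rack_iso opX opY.
Proof.
move=> cardXY surjf fM; apply: rack_iso_sym; exists f; split=> //.
apply: inj_card_bij; last by rewrite cardXY.
have /imset_injP injf : #|f @: [set: Y]| == #|[set: Y]|.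
  rewrite cardsT -cardXY -cardsT; apply/eqP/eq_card => x; rewrite inE.
  by have [y ->] := surjf x; rewrite imset_f ?inE.
by move=> x y; apply: injf; rewrite inE.
Qed.

(** For additive [b] this is [(1 - b) x + b y], the common shape of items (1) to (4). *)
Definition affine_op (V : zmodType) (b : V -> V) (x y : V) : V := b (y - x) + x.

HB.instance Definition _ (V W : finZmodType) := GRing.Zmodule.on (V * W)%type.

Lemma affine_rack_iso (X : finType) (op : X -> X -> X) (V W : finZmodType)
    (b : V -> V) (c : W -> W) (f : V -> W) :
    rack_iso op (affine_op b) -> #|V| = #|W| ->
    {morph f : x y / x + y} -> (forall x, f x = 0 -> x = 0) ->
    (forall x, f (b x) = c (f x)) ->
  rack_iso op (affine_op c).
Proof.
move=> iso_op cardVW fD inj0 fb; apply: rack_iso_trans iso_op _.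
have f0 : f 0 = 0 by apply: (addrI (f 0)); rewrite -fD !addr0.
have fN x : f (- x) = - f x by apply/eqP; rewrite -addr_eq0 -fD addNr f0.
exists f; split; last by move=> x y; rewrite /affine_op fD fb fD fN.
apply: inj_card_bij; last by rewrite cardVW.
by move=> x y eq_f; apply/eqP; rewrite -subr_eq0; apply/eqP/inj0; rewrite fD fN eq_f subrr.
Qed.

Lemma rack_iso_ext (X Y : finType) (op : X -> X -> X) (opY opY' : Y -> Y -> Y) :
  rack_iso op opY -> opY =2 opY' -> rack_iso op opY'.
Proof. by case=> f [bij_f fM] eqY; exists f; split=> // x y; rewrite fM. Qed.

Section Plane.

Variables (p : nat) (F : finFieldType).
Hypotheses (p_pr : prime p) (cardF : #|F| = (p ^ 2)%N).

Lemma Fp_embedding : exists f : {rmorphism 'F_p -> F}, True.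
Proof.
have charF : p \in [pchar F] := card_finPcharP cardF p_pr.
pose f : {rmorphism 'F_p -> pPrimeCharType charF} := GRing.in_alg (pPrimeCharType charF).
by exists f.
Qed.

Local Notation V := ('F_p * 'F_p)%type.
Let cardV : #|{: V}| = #|F|.
Proof. by rewrite card_prod card_Fp // cardF expnS expn1. Qed.

Variables (X : finType) (op : X -> X -> X).

(** The matrix with rows [(a, c)] and [(d, e)], acting on columns. *)
Definition linear2 (a c d e : 'F_p) (v : 'F_p * 'F_p) : 'F_p * 'F_p :=
  (a * v.1 + c * v.2, d * v.1 + e * v.2).

(** For a root [t] of the characteristic polynomial [chi], the functional [d * v.1 + (t - a) * v.2]
    is a left eigenvector for [t], nonzero since [d != 0]. Two distinct roots give coordinates for
    item (1), a double root gives item (2), and a root outside the prime field maps the plane onto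
    [F] as in item (3). *)
Lemma linear2_nonscalar_item a c d e (b := linear2 a c d e) :
    d != 0 -> (forall v, b v = 0 -> v = 0) -> (forall v, b v = v -> v = 0) ->
    rack_iso op (affine_op b) ->
  exists i : nat, (1 <= i <= 6)%N /\ in_item p F i op.
Proof.
move=> d0 b0 b1 iso_op.
pose chi (t : 'F_p) := t ^+ 2 - (a + e) * t + (a * e - c * d).
(* The matrix sends [(e, - d)] to [(chi 0, 0)]; likewise [b - 1] sends [(e - 1, - d)] to
   [(chi 1, 0)]. *)
have chi0 : chi 0 != 0.
  apply: contra_neq d0 => chi0; suff: (e, - d) = 0 :> 'F_p * 'F_p by move/(congr1 snd) => /= d0'; rewrite -[d]opprK d0' oppr0.
  apply: b0; rewrite /b /linear2 /=; congr (_, _); last by ring.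
  by move: chi0; rewrite /chi => chi0; rewrite -[RHS]chi0; ring.
have chi1 : chi 1 != 0.
  apply: contra_neq d0 => chi1; suff: (e - 1, - d) = 0 :> 'F_p * 'F_p by move/(congr1 snd) => /= d0'; rewrite -[d]opprK d0' oppr0.
  apply: b1; rewrite /b /linear2 /=; congr (_, _); last by ring.
  by apply/eqP; rewrite -subr_eq0 -chi1 /chi; apply/eqP; ring.
have [alpha /eqP root_al | noroot] := pickP (fun t => chi t == 0).
  pose beta := a + e - alpha.
  have Dc : c * d = a * e - alpha * beta.
    apply/eqP; rewrite -subr_eq0 -oppr_eq0 -root_al /chi /beta; apply/eqP; ring.
  have u_al : unit_ne1 alpha.
    by apply/andP; split; [apply: contra_neq chi0 | apply: contra_neq chi1] => al; rewrite -[X in chi X]al.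
  have u_be : unit_ne1 beta.
    apply/andP; split; [apply: contra_neq chi0 | apply: contra_neq chi1] => be; rewrite /chi Dc be.
      by ring.
    by have -> : a = 1 + alpha - e; [rewrite -be /beta; ring | ring].
  have [eq_ab | ne_ab] := eqVneq alpha beta.
    have Da : a = alpha + alpha - e by rewrite {2}eq_ab /beta; ring.
    exists 2%N; split=> //; exists alpha; split=> //.
    (* Here [e - alpha = alpha - a], so the second coordinate of [b v] is [alpha * v.2] plus the
       eigenfunctional. *)
    pose f (v : V) : V := (d * v.1 + (alpha - a) * v.2, v.2).
    apply: (@rack_iso_ext _ _ _ (affine_op (fun v : V => (alpha * v.1, alpha * v.2 + v.1) : V))); last first.
      by move=> x y; rewrite /affine_op /rack2; congr (_, _) => /=; ring.
    apply: (affine_rack_iso iso_op (f := f)) => // [v w|[v1 v2] fv0|v].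
    - by rewrite /f /=; congr (_, _) => /=; ring.
    - have /= v20 := congr1 snd fv0; have /= := congr1 fst fv0.
      by rewrite v20 mulr0 addr0 => /eqP; rewrite mulf_eq0 (negPf d0) => /eqP ->.
    - rewrite /f /b /linear2 /=; congr (_, _) => /=; last by rewrite Da; ring.
      have -> : d * (a * v.1 + c * v.2) = d * a * v.1 + (c * d) * v.2 by ring.
      by rewrite Dc -eq_ab Da; ring.
  exists 1%N; split=> //; exists alpha, beta; split=> //.
  pose f (v : V) : V := (d * v.1 + (alpha - a) * v.2, d * v.1 + (beta - a) * v.2).
  apply: (@rack_iso_ext _ _ _ (affine_op (fun v : V => (alpha * v.1, beta * v.2) : V))); last first.
    by move=> x y; rewrite /affine_op /rack1; congr (_, _) => /=; ring.
  apply: (affine_rack_iso iso_op (f := f)) => // [v w|[v1 v2] fv0|v].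
  - by rewrite /f /=; congr (_, _) => /=; ring.
  - have /= f1 := congr1 fst fv0; have /= f2 := congr1 snd fv0.
    have v20 : v2 = 0.
      have /eqP : (alpha - beta) * v2 = 0 by rewrite -[RHS](subrr 0) -{1}f1 -f2; ring.
      by rewrite mulf_eq0 subr_eq0 (negPf ne_ab) => /eqP.
    by move: f1; rewrite v20 mulr0 addr0 => /eqP; rewrite mulf_eq0 (negPf d0) => /eqP ->.
  - rewrite /f /b /linear2 /=.
    have -> : d * (a * v.1 + c * v.2) = d * a * v.1 + (c * d) * v.2 by ring.
    by rewrite Dc /beta; congr (_, _) => /=; ring.
have [iota _] := Fp_embedding.
pose h : {poly 'F_p} := 'X^2 - (a + e) *: 'X + (a * e - c * d)%:P.
have hE : h = 'X^2 + (- (a + e) *: 'X + (a * e - c * d)%:P) by rewrite /h scaleNr addrA.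
have sz : (size (- (a + e) *: 'X + (a * e - c * d)%:P : {poly 'F_p})%R <= 2)%N.
  rewrite (leq_trans (size_polyD _ _)) // geq_max (leq_trans (size_scale_leq _ _)) ?size_polyX //=.
  by rewrite (leq_trans (size_polyC_leq1 _)).
have size_h : size h = 3%N by rewrite hE size_polyDl ?size_polyXn.
have mon_h : h \is monic by rewrite monicE hE lead_coefDl ?size_polyXn ?lead_coefXn.
have hornE t : h.[t] = chi t by rewrite /h /chi !hornerE; ring.
have [|alpha] := quadratic_root_or_ext iota p_pr cardF mon_h size_h.
  by move=> t; rewrite /root hornE noroot.
rewrite /root /h rmorphD rmorphB /= map_polyXn map_polyZ map_polyX map_polyC /= !hornerE.
move=> /eqP root_al.
have nal t : iota t != alpha.
  apply/eqP => Dal; move/negP: (noroot t); apply; rewrite -(fmorph_eq0 iota) /chi.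
  by rewrite rmorphD rmorphB rmorphXn rmorphM Dal root_al.
exists 3%N; split=> //; exists alpha; split.
  by case=> n Dn; case/eqP: (nal n%:R); rewrite rmorph_nat.
pose f (v : V) : F := iota d * iota v.1 + (alpha - iota a) * iota v.2.
apply: (@rack_iso_ext _ _ _ (affine_op (fun x : F => alpha * x))); last first.
  by move=> x y; rewrite /affine_op /rack3; ring.
apply: (affine_rack_iso iso_op (f := f)) => // [v w|[v1 v2]|v].
- by rewrite /f /= !rmorphD; ring.
- rewrite /f /=; have [->|v20] := eqVneq v2 0.
    rewrite rmorph0 mulr0 addr0 -rmorphM => /eqP; rewrite fmorph_eq0 mulf_eq0 (negPf d0) /=.
    by move=> /eqP ->.
  move=> f0; case/eqP: (nal (a - d * v1 / v2)).
  have iv2 : iota v2 != 0 by rewrite fmorph_eq0.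
  rewrite rmorphB fmorph_div rmorphM; apply: (mulIf iv2).
  by rewrite mulrBl divfK // -[RHS]subr0 -f0; ring.
- rewrite /f /b /linear2 /= !rmorphD !rmorphM.
  apply/eqP; rewrite -subr_eq0; apply/eqP.
  transitivity (- (alpha ^+ 2 - iota (a + e) * alpha + iota (a * e - c * d)) * iota v.2).
    by rewrite rmorphB !rmorphM rmorphD; ring.
  by rewrite root_al oppr0 mul0r.
Qed.

End Plane.

Section ZpPower.

Variables (gT : finGroupType) (m : nat) (z : gT).
Hypotheses (m_gt1 : (1 < m)%N) (zm : (z ^+ m)%g = 1%g).

Lemma expg_ZpD (i j : 'Z_m) : (z ^+ (i + j)%R)%g = (z ^+ i * z ^+ j)%g.
Proof. by rewrite /= expg_mod -?expgD // Zp_cast. Qed.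

Lemma expg_ZpM (i j : 'Z_m) : (z ^+ (i * j)%R)%g = (z ^+ i ^+ j)%g.
Proof. by rewrite /= expg_mod -?expgM // Zp_cast. Qed.

Lemma expg_Zp_nat k : (z ^+ (k%:R : 'Z_m))%g = (z ^+ k)%g.
Proof. by rewrite val_Zp_nat // expg_mod. Qed.

End ZpPower.

Section Plane.

Variables (p : nat) (F : finFieldType).
Hypotheses (p_pr : prime p) (cardF : #|F| = (p ^ 2)%N).
Variables (X : finType) (op : X -> X -> X).

Lemma additive_planeE (b : 'F_p * 'F_p -> 'F_p * 'F_p) : {morph b : x y / x + y} ->
  b =1 linear2 (b (1, 0)).1 (b (0, 1)).1 (b (1, 0)).2 (b (0, 1)).2.
Proof.
move=> bD; have b0 : b 0 = 0 by apply: (addrI (b 0)); rewrite -bD !addr0.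
have bMn v n : b (v *+ n) = b v *+ n.
  by elim: n => [|n IHn]; rewrite ?mulr0n // !mulrS bD IHn.
have pairMn (u : 'F_p * 'F_p) n : u *+ n = (u.1 *+ n, u.2 *+ n).
  by elim: n => [|n IHn]; [case: u | rewrite !mulrS IHn].
move=> [v1 v2].
have {1}-> : (v1, v2) = (1, 0) *+ v1 + (0, 1) *+ v2 :> 'F_p * 'F_p.
  by rewrite !pairMn /= !mul0rn !natr_Zp; congr (_, _); rewrite ?addr0 ?add0r.
rewrite bD !bMn !pairMn /linear2 /=; congr (_, _) => /=;
  by rewrite -(mulr_natr _ (v1 : nat)) -(mulr_natr _ (v2 : nat)) !natr_Zp.
Qed.

(** A diagonal matrix is already in item (1). Otherwise an off-diagonal entry is nonzero, and
    exchanging the coordinates if necessary makes it the lower left one. *)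
Lemma affine_plane_item (b : 'F_p * 'F_p -> 'F_p * 'F_p) : {morph b : x y / x + y} ->
    (forall v, b v = 0 -> v = 0) -> (forall v, b v = v -> v = 0) ->
    rack_iso op (affine_op b) ->
  exists i : nat, (1 <= i <= 6)%N /\ in_item p F i op.
Proof.
move=> bD binj bfix iso_op.
have bE := additive_planeE bD.
move: (b (1, 0)).1 (b (0, 1)).1 (b (1, 0)).2 (b (0, 1)).2 bE => a c d e bE.
have iso_l : rack_iso op (affine_op (linear2 a c d e)).
  by apply: rack_iso_ext iso_op _ => x y; rewrite /affine_op bE.
have linj v : linear2 a c d e v = 0 -> v = 0 by move=> lv; apply: binj; rewrite bE.
have lfix v : linear2 a c d e v = v -> v = 0 by move=> lv; apply: bfix; rewrite bE.
have [d0|] := eqVneq d 0; last by move=> d0; exact: (linear2_nonscalar_item p_pr cardF d0 linj lfix iso_l).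
have [c0|c0] := eqVneq c 0.
  exists 1%N; split=> //; exists a, e; split.
  - apply/andP; split; apply/eqP => Da.
      have /(congr1 fst)/eqP : (1, 0) = 0 :> 'F_p * 'F_p.
        by apply: linj; rewrite /linear2 Da d0 /= !(mul0r, mulr0, addr0).
      by rewrite oner_eq0.
    have /(congr1 fst)/eqP : (1, 0) = 0 :> 'F_p * 'F_p.
      by apply: lfix; rewrite /linear2 Da d0 /= !(mul0r, mulr0, mulr1, addr0).
    by rewrite oner_eq0.
  - apply/andP; split; apply/eqP => De.
      have /(congr1 snd)/eqP : (0, 1) = 0 :> 'F_p * 'F_p.
        by apply: linj; rewrite /linear2 De c0 /= !(mul0r, mulr0, addr0).
      by rewrite oner_eq0.
    have /(congr1 snd)/eqP : (0, 1) = 0 :> 'F_p * 'F_p.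
      by apply: lfix; rewrite /linear2 De c0 /= !(mul0r, mulr0, mulr1, addr0, add0r).
    by rewrite oner_eq0.
  apply: rack_iso_ext iso_l _ => x y; rewrite /affine_op /linear2 /rack1 c0 d0.
  by congr (_, _) => /=; ring.
pose swap (v : 'F_p * 'F_p) := (v.2, v.1).
have swapK v : swap (swap v) = v by case: v.
have swapE v : linear2 e d c a v = swap (linear2 a c d e (swap v)).
  by rewrite /linear2 /swap /=; congr (_, _); rewrite addrC.
apply: (linear2_nonscalar_item p_pr cardF c0 (a := e) (c := d) (e := a)).
- by move=> v; rewrite swapE => /(congr1 swap); rewrite swapK => /linj/(congr1 swap); rewrite swapK.
- by move=> v; rewrite swapE => /(congr1 swap); rewrite swapK => /lfix/(congr1 swap); rewrite swapK.
apply: (affine_rack_iso iso_l (f := swap)) => //.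
by move=> v /(congr1 swap); rewrite swapK.
Qed.

End Plane.

(** * From the group structure to the six items *)

Section Classification.

Variables (p : nat) (F : finFieldType).
Hypotheses (p_pr : prime p) (cardF : #|F| = (p ^ 2)%N).
Variables (X : finType) (op : X -> X -> X).
Hypothesis cardX : #|X| = (p ^ 2)%N.
Variables (gT : finGroupType) (N : {group gT}) (s : gT) (m : nat) (g : gT -> nat -> X).
Hypotheses (abN : abelian N) (nNs : s \in 'N(N)%g) (regs : 'C_N[s]%g = 1%g).
Hypothesis cardNm : (#|N| * m = p ^ 2)%N.
Hypothesis opg : {in N &, forall n n' k k', op (g n k) (g n' k') = g ((n' * n^-1) ^ s * n)%g k'.+1}.
Hypothesis gm : {in N, forall n k, g n (k + m) = g n k}%N.
Hypothesis g_onto : forall y, exists2 n, n \in N & exists k, y = g n k.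

Let p_gt1 : (1 < p)%N. Proof. exact: prime_gt1. Qed.
Let p2_gt1 : (1 < p ^ 2)%N. Proof. by rewrite -{1}(exp1n 2) ltn_exp2r. Qed.

Let g_mod n k : n \in N -> g n (k %% m) = g n k.
Proof.
move=> Nn; rewrite [in RHS](divn_eq k m) addnC; elim: (k %/ m)%N => [|i IHi].
  by rewrite mul0n addn0.
by rewrite mulSn [(m + _)%N]addnC addnA gm.
Qed.

Let fixed1 n : n \in N -> (n ^ s)%g = n -> n = 1%g.
Proof.
move=> Nn ns; apply/set1gP; rewrite -regs inE Nn.
by apply/cent1P/commgP/conjg_fixP.
Qed.

Let item5 : #|N| = 1%N -> in_item p F 5 op.
Proof.
move=> N1; have Dm : m = (p ^ 2)%N by rewrite -cardNm N1 mul1n.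
have gq n k : n \in N -> g n (k %% p ^ 2) = g n k by move=> Nn; rewrite -Dm g_mod.
have N_1 n : n \in N -> n = 1%g by rewrite (card1_trivg N1) => /set1P.
apply: (surj_rack_iso (f := fun k : 'Z_(p ^ 2) => g 1%g k)).
- by rewrite cardX card_ord Zp_cast.
- move=> y; have [n /N_1 -> [k ->]] := g_onto y; exists (k%:R : 'Z_(p ^ 2)).
  by rewrite val_Zp_nat // gq.
move=> k k'; rewrite opg // mulgV conj1g mulg1 /rack5.
have -> : k' + 1 = k'.+1%:R by rewrite mulrSr natr_Zp.
by rewrite val_Zp_nat // gq.
Qed.

Let conj_cycle z : N :=: <[z]>%g -> exists k, (z ^ s)%g = (z ^+ k)%g.
Proof. by move=> defN; apply/cycleP; rewrite -defN memJ_norm // defN cycle_id. Qed.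

Let item6 : #|N| = p -> in_item p F 6 op.
Proof.
move=> Np; have Dm : m = p by apply/eqP; rewrite -(eqn_pmul2l (prime_gt0 p_pr)) -{1}Np cardNm expnS expn1.
(* ['F_p] unfolds to residues modulo [pdiv p], which is [p] here. *)
have gq n k : n \in N -> g n (k %% pdiv p) = g n k.
  by move=> Nn; rewrite pdiv_id // -[X in (_ %% X)%N]Dm g_mod.
have /cyclicP[z defN] : cyclic N by apply: prime_cyclic; rewrite Np.
have Nz : z \in N by rewrite defN cycle_id.
have zp : (z ^+ pdiv p)%g = 1%g by rewrite pdiv_id // -Np expg_cardG.
have z1 : z != 1%g.
  by apply: contraTneq p_gt1 => z1; rewrite -Np defN z1 cycle1 cards1.
have q_gt1 : (1 < pdiv p)%N by rewrite pdiv_id.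
(* Conjugation by [s] multiplies exponents by [a]; injectivity excludes [a = 0] and [regs] excludes
   [a = 1]. *)
have [k zs] := conj_cycle defN; pose a : 'F_p := k%:R.
have eJ (i : 'F_p) : ((z ^+ i) ^ s = z ^+ (a * i)%R)%g.
  by rewrite expg_ZpM // expg_Zp_nat // conjXg zs.
have eN (i : 'F_p) : ((z ^+ i)^-1 = z ^+ (- i)%R)%g.
  by apply/eqP; rewrite eq_invg_mul -expg_ZpD // subrr.
have zs' : (z ^ s = z ^+ a)%g by rewrite expg_Zp_nat.
exists a; split.
  apply/andP; split; apply: contraNneq z1 => a01; apply/eqP; move: zs'; rewrite a01.
    by move=> /(congr1 (fun h => h ^ s^-1)%g); rewrite conjgK => ->; rewrite conj1g.
  by rewrite /= modn_small ?Zp_cast // expg1 => /(fixed1 Nz).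
apply: (surj_rack_iso (f := fun x : 'F_p * 'F_p => g (z ^+ x.1)%g x.2)).
- by rewrite cardX card_prod card_Fp // expnS expn1.
- move=> y; have [n Nn [j ->]] := g_onto y; move: Nn; rewrite defN => /cycleP[i ->].
  by exists (i%:R, j%:R) => /=; rewrite expg_Zp_nat // val_Zp_nat // gq // groupX.
move=> [x1 x2] [y1 y2].
change (g (z ^+ ((1 - a) * x1 + a * y1)%R)%g (y2 + 1)%R = op (g (z ^+ x1)%g x2) (g (z ^+ y1)%g y2)).
rewrite opg ?groupX // eN -expg_ZpD // eJ -expg_ZpD //.
rewrite (_ : a * (y1 - x1) + x1 = (1 - a) * x1 + a * y1); last by ring.
have -> : y2 + 1 = y2.+1%:R by rewrite mulrSr natr_Zp.
by rewrite val_Zp_nat // gq ?groupX.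
Qed.

(** Now [m = 1], so the height [k] is immaterial and [X] is [N] itself, written additively through
    [e]. *)
Let affine_item (V : finZmodType) (b : V -> V) (e : V -> gT) :
    #|N| = (p ^ 2)%N -> #|V| = (p ^ 2)%N ->
    (forall x, e x \in N) -> (forall n, n \in N -> exists x, n = e x) ->
    (forall x y, e (x + y) = (e x * e y)%g) ->
    (forall x, e (b x) = (e x ^ s)%g) ->
  rack_iso op (affine_op b).
Proof.
move=> N2 cardV Ne e_onto eD eb.
have Dm : m = 1%N by apply/eqP; rewrite -(eqn_pmul2l (ltnW p2_gt1)) -{1}N2 cardNm muln1.
have e0 : e 0 = 1%g by apply: (mulgI (e 0)); rewrite -eD addr0 mulg1.
have eN x : e (- x) = (e x)^-1%g.
  by apply: (mulgI (e x)); rewrite -eD subrr e0 mulgV.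
have g0 n k : n \in N -> g n k = g n 0%N by move=> Nn; rewrite -(g_mod k Nn) Dm modn1.
apply: (surj_rack_iso (f := fun x : V => g (e x) 0%N)); first by rewrite cardX cardV.
  by move=> y; have [n Nn [k ->]] := g_onto y; have [x ->] := e_onto n Nn; exists x; rewrite g0.
move=> x y; have Nxy : ((e y * (e x)^-1) ^ s * e x)%g \in N.
  by rewrite groupM // memJ_norm // groupM // groupV.
by rewrite opg // [in RHS]g0 // /affine_op eD eb eD eN.
Qed.

Let item4 : #|N| = (p ^ 2)%N -> cyclic N -> in_item p F 4 op.
Proof.
move=> N2 /cyclicP[z defN].
have Nz : z \in N by rewrite defN cycle_id.
have oz : #[z]%g = (p ^ 2)%N by rewrite -N2 defN.
have z2 : (z ^+ (p ^ 2))%g = 1%g by rewrite -oz expg_order.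
have [k zs] := conj_cycle defN; pose a : 'Z_(p ^ 2) := k%:R.
have p_gt0 := prime_gt0 p_pr.
(* The condition on [a] modulo [p] is tested on [z ^+ p], of order [p], where [s] acts through
   [a %% p]. *)
have zp1 : (z ^+ p)%g != 1%g.
  by rewrite -order_dvdn oz; apply/negP => /(dvdn_leq p_gt0); rewrite leqNgt expnS expn1 ltn_Pmull.
have zpk j : (z ^+ (p * j) = z ^+ (p * (j %% p)))%g.
  have {1}-> : (p * j = p ^ 2 * (j %/ p) + p * (j %% p))%N.
    by rewrite {1}(divn_eq j p) expnS expn1; ring.
  by rewrite expgD expgM z2 expg1n mul1g.
have zpJ : ((z ^+ p) ^ s = z ^+ (p * (a %% p)))%g.
  rewrite conjXg zs -expgM [(k * p)%N]mulnC [LHS]zpk; congr (z ^+ (p * _))%g.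
  by rewrite /a val_Zp_nat // modn_dvdm ?dvdn_exp.
exists a; split.
  apply/andP; split; apply: contraNneq zp1 => a01; apply/eqP; move: zpJ; rewrite a01.
    by rewrite muln0 expg0 => /(congr1 (fun h => h ^ s^-1)%g); rewrite conjgK conj1g.
  by rewrite muln1 => /fixed1; apply; rewrite groupX.
apply: (@rack_iso_ext _ _ _ (affine_op (fun x : 'Z_(p ^ 2) => a * x))); last first.
  by move=> x y; rewrite /affine_op /rack4; ring.
apply: (affine_item (e := fun x : 'Z_(p ^ 2) => (z ^+ x)%g)) => //.
- by rewrite card_ord Zp_cast.
- by move=> x; rewrite groupX.
- by move=> n; rewrite defN => /cycleP[i ->]; exists i%:R; rewrite expg_Zp_nat.
- by move=> x y; rewrite expg_ZpD.
by move=> x; rewrite expg_ZpM // expg_Zp_nat // conjXg zs.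
Qed.

(** A noncyclic [N] has exponent [p], so [u != 1] and [w] outside [<[u]>] form a basis, and [b] is
    conjugation by [s] in these coordinates. *)
Let item123 : #|N| = (p ^ 2)%N -> ~~ cyclic N ->
  exists i : nat, (1 <= i <= 6)%N /\ in_item p F i op.
Proof.
move=> N2 ncN.
have expN n : n \in N -> (n ^+ pdiv p)%g = 1%g.
  move=> Nn; rewrite pdiv_id //; apply/eqP; rewrite -order_dvdn.
  have /(dvdn_pfactor _ _ p_pr)[[|[|[|j]]] // le_j on] : (#[n]%g %| p ^ 2)%N by rewrite -N2 order_dvdG.
  - by rewrite on dvd1n.
  - by rewrite on.
  case/negP: ncN; apply/cyclicP; exists n; apply/eqP.
  by rewrite eq_sym eqEcard cycle_subG Nn N2 -[#|_|]/(#[n]%g) on /=.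
have q_gt1 : (1 < pdiv p)%N by rewrite pdiv_id.
have /trivgPn[u Nu u1] : N :!=: 1%g.
  by apply: contraNneq ncN => ->; exact: cyclic1.
have /subsetPn[w Nw nuw] : ~~ (N \subset <[u]>%g).
  apply: contra ncN => sNu; apply/cyclicP; exists u; apply/eqP.
  by rewrite eqEsubset sNu cycle_subG.
have cuw i j : commute (u ^+ i)%g (w ^+ j)%g.
  by apply: (centsP abN); rewrite groupX.
pose e (x : 'F_p * 'F_p) := (u ^+ x.1 * w ^+ x.2)%g.
have eD x y : e (x + y) = (e x * e y)%g.
  rewrite /e /= !expg_ZpD ?expN // !mulgA; congr (_ * _)%g.
  by rewrite -!mulgA; congr (_ * _)%g; rewrite cuw.
have Ne x : e x \in N by rewrite groupM ?groupX.
have e0 : e 0 = 1%g by rewrite /e /= mulg1.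
have inj0 x : e x = 1%g -> x = 0.
  case: x => x1 x2 ex1.
  have unitX v (x : 'F_p) : v \in N -> x != 0 -> (v ^+ x ^+ (x^-1)%R)%g = v.
    by move=> Nv nx; rewrite -expg_ZpM ?expN // mulfV //= modn_small ?Zp_cast.
  have x20 : x2 = 0.
    apply: contraNeq nuw => nx2; rewrite -(unitX w x2) // groupX //.
    move: ex1 => /eqP; rewrite /e /= -eq_invg_mul => /eqP <-.
    by rewrite groupV groupX ?cycle_id.
  move: ex1; rewrite x20 /e /= mulg1 => ux1; congr (_, _).
  by apply: contraNeq u1 => nx1; rewrite -(unitX u x1) // ux1 expg1n.
have eV x : e (- x) = (e x)^-1%g.
  by apply: (mulgI (e x)); rewrite -eD subrr e0 mulgV.
have inje : injective e.
  move=> x y exy; apply/eqP; rewrite -subr_eq0; apply/eqP/inj0.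
  by rewrite eD eV exy mulgV.
have cardV : #|{: 'F_p * 'F_p}| = (p ^ 2)%N by rewrite card_prod card_Fp // expnS expn1.
have e_im : e @: [set: 'F_p * 'F_p] = N.
  apply/eqP; rewrite eqEcard card_imset // cardsT cardV N2 leqnn andbT.
  by apply/subsetP => _ /imsetP[x _ ->].
have e_onto n : n \in N -> exists x, n = e x.
  by rewrite -e_im => /imsetP[x _ ->]; exists x.
have /fin_all_exists[b bE] x : exists y, (e x ^ s)%g = e y.
  by apply: e_onto; rewrite memJ_norm.
apply: (affine_plane_item p_pr cardF (b := b)).
- by move=> x y; apply: inje; rewrite -bE !eD conjMg !bE.
- move=> v bv; apply: inj0; apply: (@conjg_inj _ s).
  by rewrite bE bv e0 conj1g.
- by move=> v bv; apply: inj0; apply: fixed1; rewrite // bE bv.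
by apply: (affine_item (e := e)).
Qed.

Lemma rack_structure_item : exists i : nat, (1 <= i <= 6)%N /\ in_item p F i op.
Proof.
have /(dvdn_pfactor _ _ p_pr)[[|[|[|j]]] // _ cardN] : (#|N| %| p ^ 2)%N.
- by rewrite -cardNm dvdn_mulr.
- by exists 5%N; split=> //; exact: item5.
- by exists 6%N; split=> //; apply: item6; rewrite cardN expn1.
have [cN|ncN] := boolP (cyclic N); last exact: item123.
by exists 4%N; split=> //; exact: item4.
Qed.

End Classification.

Theorem indecomposable_rack_item (p : nat) (F : finFieldType) (X : finType) (op : X -> X -> X) :
    prime p -> #|F| = (p ^ 2)%N -> is_rack op -> indecomposable op -> #|X| = (p ^ 2)%N ->
  exists i : nat, (1 <= i <= 6)%N /\ in_item p F i op.
Proof.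
move=> p_pr cardF rackX indecX cardX.
have [gT [N [s [m [g [abN nNs regs cardNm [opg gm g_onto]]]]]]] :=
  indecomposable_rack_structure rackX indecX p_pr cardX.
exact: (rack_structure_item p_pr cardF cardX abN nNs regs cardNm opg gm g_onto).
Qed.

(** * Isomorphisms between the racks of the list *)

(** On a finite group the two last conditions make [b] and [1 - b] bijective; this forces rack
    isomorphisms to be additive up to a translation. *)
Record affine_map (V : zmodType) (b : V -> V) : Prop := AffineMap {
  affine_mapD : {morph b : x y / x + y};
  affine_map_inj0 : forall v, b v = 0 -> v = 0;
  affine_map_fix0 : forall v, b v = v -> v = 0 }.

Section Additive.

Variables (V W : zmodType) (f : V -> W).
Hypothesis fD : {morph f : x y / x + y}.

Lemma morphD0 : f 0 = 0.
Proof. by apply: (addrI (f 0)); rewrite -fD !addr0. Qed.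

Lemma morphDN x : f (- x) = - f x.
Proof. by apply/eqP; rewrite -addr_eq0 -fD addNr morphD0. Qed.

Lemma morphDMn x n : f (x *+ n) = f x *+ n.
Proof. by elim: n => [|n IHn]; rewrite ?mulr0n ?morphD0 // !mulrS fD IHn. Qed.

End Additive.

(* Replacing the isomorphism [h] by [h - h 0], additivity is read off the two
   identities obtained by putting 0 on either side of the operation. *)
Lemma affine_rack_iso_additive (V W : finZmodType) (b : V -> V) (c : W -> W) :
    affine_map b -> affine_map c -> rack_iso (affine_op b) (affine_op c) ->
  exists f : V -> W, [/\ bijective f, {morph f : x y / x + y} & forall v, f (b v) = c (f v)].
Proof.
case=> bD b0 b1 [cD c0 c1] [h [bij_h hM]].
have bN := morphDN bD; have cN := morphDN cD.
pose f v := h v - h 0.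
have fM x y : f (affine_op b x y) = affine_op c (f x) (f y).
  rewrite /f hM /affine_op -addrA; congr (c _ + _).
  by rewrite opprB addrA subrK.
have f0 : f 0 = 0 by rewrite /f subrr.
have fb y : f (b y) = c (f y).
  by have := fM 0 y; rewrite /affine_op f0 !subr0 !addr0.
have f1b x : f (x - b x) = f x - c (f x).
  by have := fM x 0; rewrite /affine_op f0 !sub0r bN cN addrC => ->; rewrite addrC.
have surj_b v : exists y, v = b y.
  have injb : injective b.
    move=> x y bxy; apply/eqP; rewrite -subr_eq0; apply/eqP/b0.
    by rewrite bD bN bxy subrr.
  by have [g _ gK] := injF_bij injb; exists (g v); rewrite gK.
have surj_1b u : exists x, u = x - b x.
  have inj1b : injective (fun x => x - b x).
    move=> x y /eqP eq1; apply/eqP; rewrite -subr_eq0; apply/eqP/b1.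
    rewrite bD bN; apply/eqP; rewrite eq_sym -subr_eq0 opprB.
    have -> : x - y + (b y - b x) = (x - b x) - (y - b y).
      by rewrite opprB addrACA [RHS]addrACA [- y - _]addrC.
    by rewrite subr_eq0.
  by have [g _ gK] := injF_bij inj1b; exists (g u); rewrite gK.
exists f; split=> //.
  have [g hK gK] := bij_h; exists (fun w => g (w + h 0)).
    by move=> v; rewrite /f subrK hK.
  by move=> w; rewrite /f gK addrK.
(* As [1 - b] and [b] are onto, any sum [u + v] has the form [(1 - b) x + b y]. *)
move=> u v; have [x ->] := surj_1b u; have [y ->] := surj_b v.
have -> : x - b x + b y = affine_op b x y by rewrite /affine_op bD bN [LHS]addrC -addrA [- b x + x]addrC.
by rewrite fM f1b fb /affine_op cD cN [RHS]addrC -addrA [- c (f x) + _]addrC.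
Qed.

Section Items.

Variables (p : nat) (F : finFieldType).
Hypotheses (p_pr : prime p) (cardF : #|F| = (p ^ 2)%N).

Local Notation V := ('F_p * 'F_p)%type.

Let p2_gt1 : (1 < p ^ 2)%N.
Proof. by rewrite -{1}(exp1n 2) ltn_exp2r ?prime_gt1. Qed.

Let pcharF : p \in [pchar F]. Proof. exact: card_finPcharP cardF p_pr. Qed.

Definition map1 (a b : 'F_p) (v : V) : V := (a * v.1, b * v.2).
Definition map2 (a : 'F_p) (v : V) : V := (a * v.1, a * v.2 + v.1).

Lemma rack1E a b : rack1 a b =2 affine_op (map1 a b).
Proof. by move=> x y; rewrite /affine_op /rack1; congr (_, _) => /=; ring. Qed.

Lemma rack2E a : rack2 a =2 affine_op (map2 a).
Proof. by move=> x y; rewrite /affine_op /rack2; congr (_, _) => /=; ring. Qed.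

Lemma rack3E (a : F) : rack3 a =2 affine_op (fun x => a * x).
Proof. by move=> x y; rewrite /affine_op /rack3; ring. Qed.

Lemma rack4E (a : 'Z_(p ^ 2)) : rack4 a =2 affine_op (fun x => a * x).
Proof. by move=> x y; rewrite /affine_op /rack4; ring. Qed.

Lemma rack_iso_ext2 (X Y : finType) (opX opX' : X -> X -> X) (opY opY' : Y -> Y -> Y) :
  opX =2 opX' -> opY =2 opY' -> rack_iso opX opY -> rack_iso opX' opY'.
Proof.
move=> eX eY /rack_iso_ext/(_ eY)/rack_iso_sym/rack_iso_ext/(_ eX).
exact: rack_iso_sym.
Qed.

Lemma mul_affine_map (R : comUnitRingType) (a : R) :
  a \is a GRing.unit -> 1 - a \is a GRing.unit -> affine_map (fun x : R => a * x).
Proof.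
move=> ua u1a; split=> [x y|x|x ax]; first exact: mulrDr.
  by move/(congr1 (fun x => a^-1 * x)); rewrite mulKr // mulr0.
by apply: (mulrI u1a); rewrite mulr0 mulrBl mul1r ax subrr.
Qed.

Lemma field_mul_affine_map (K : fieldType) (a : K) :
  a != 0 -> a != 1 -> affine_map (fun x => a * x).
Proof. by move=> a0 a1; apply: mul_affine_map; rewrite unitfE // subr_eq0 eq_sym. Qed.

Lemma map1_affine a b : unit_ne1 a -> unit_ne1 b -> affine_map (map1 a b).
Proof.
move=> /andP[a0 a1] /andP[b0 b1].
have [aD ainj afix] := field_mul_affine_map a0 a1.
have [bD binj bfix] := field_mul_affine_map b0 b1.
split=> [x y|[x y] e|[x y] e].
- by rewrite /map1 /= aD bD.
- by rewrite (ainj x (congr1 fst e)) (binj y (congr1 snd e)).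
- by rewrite (afix x (congr1 fst e)) (bfix y (congr1 snd e)).
Qed.

Lemma map2_affine a : unit_ne1 a -> affine_map (map2 a).
Proof.
move=> /andP[a0 a1]; have [aD ainj afix] := field_mul_affine_map a0 a1.
split=> [x y|[x y] e|[x y] e].
- by rewrite /map2 /=; congr (_, _) => /=; ring.
- have x0 := ainj x (congr1 fst e); have := congr1 snd e.
  by rewrite /= x0 addr0 => /ainj ->.
- have x0 := afix x (congr1 fst e); have := congr1 snd e.
  by rewrite /= x0 addr0 => /afix ->.
Qed.

Lemma not_prime_subfield_affine (a : F) : ~ in_prime_subfield a -> affine_map (fun x => a * x).
Proof.
move=> na; apply: field_mul_affine_map; apply/eqP => a01; apply: na.
  by exists 0%N; rewrite a01.
by exists 1%N; rewrite a01.
Qed.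

(** Units modulo [p ^ 2] are the residues not divisible by [p], so the condition says that [a] and
    [1 - a] are units. *)
Lemma valid4_affine (a : 'Z_(p ^ 2)) : valid4 a -> affine_map (fun x => a * x).
Proof.
have p_gt1 := prime_gt1 p_pr.
have unitE (k : nat) : ((k%:R : 'Z_(p ^ 2)) \is a GRing.unit) = (k %% p != 0)%N.
  by rewrite unitZpE // coprime_pexpl // prime_coprime.
case/andP => a0 a1; apply: mul_affine_map; first by rewrite -[a]natr_Zp unitE.
have a_gt0 : (0 < a)%N by case: (nat_of_ord a) a0 => //; rewrite mod0n.
have -> : 1 - a = - (a.-1)%:R.
  by rewrite -opprB; congr (- _); rewrite -[X in X - 1]natr_Zp -{1}(prednK a_gt0) mulrSr addrK.
rewrite unitrN unitE; apply: contra a1 => /dvdnP[k ak].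
by rewrite -(prednK a_gt0) ak -addn1 modnMDl modn_small.
Qed.

Lemma rack_iso_additive (U W : finZmodType) (opU : U -> U -> U) (opW : W -> W -> W) b c :
    opU =2 affine_op b -> opW =2 affine_op c -> affine_map b -> affine_map c ->
    rack_iso opU opW ->
  exists f : U -> W, [/\ bijective f, {morph f : x y / x + y} & forall v, f (b v) = c (f v)].
Proof. by move=> eU eW affb affc /(rack_iso_ext2 eU eW); exact: affine_rack_iso_additive. Qed.

Lemma bij_morphD_neq0 (U W : zmodType) (f : U -> W) v :
  bijective f -> {morph f : x y / x + y} -> v != 0 -> f v != 0.
Proof.
move=> bij_f fD; apply: contra_neq => fv0; apply: (bij_inj bij_f).
by rewrite fv0 morphD0.
Qed.

Lemma Fp_mulrn (a x : 'F_p) : a * x = x *+ a.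
Proof. by rewrite -mulr_natl natr_Zp. Qed.

Lemma plane_mulrn (v : V) k : v *+ k = (v.1 *+ k, v.2 *+ k).
Proof. by elim: k => [|k IHk]; [case: v | rewrite !mulrS IHk]. Qed.

Lemma plane_e1_neq0 : (1, 0) != 0 :> V.
Proof. by apply/eqP => /(congr1 fst)/eqP; rewrite oner_eq0. Qed.

Lemma plane_e2_neq0 : (0, 1) != 0 :> V.
Proof. by apply/eqP => /(congr1 snd)/eqP; rewrite oner_eq0. Qed.

(** Eigenvalue equations are stated with [*+] so that any additive map transports them. *)
Lemma map1_e1 a b : map1 a b (1, 0) = (1, 0) *+ a.
Proof. by rewrite plane_mulrn /map1 /= mulr0 mulr1 mul0rn natr_Zp. Qed.

Lemma map1_e2 a b : map1 a b (0, 1) = (0, 1) *+ b.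
Proof. by rewrite plane_mulrn /map1 /= mulr0 mulr1 mul0rn natr_Zp. Qed.

Lemma map2_e2 a : map2 a (0, 1) = (0, 1) *+ a.
Proof. by rewrite plane_mulrn /map2 /= mulr0 mulr1 addr0 mul0rn natr_Zp. Qed.

Lemma map1_eigen a b (k : 'F_p) v : map1 a b v = v *+ k -> v != 0 -> k = a \/ k = b.
Proof.
case: v => x y; rewrite plane_mulrn /map1 /= -!Fp_mulrn => e nz.
have /= ex := congr1 fst e; have /= ey := congr1 snd e.
have [x0|x0] := eqVneq x 0; last by left; rewrite (mulIf x0 ex).
have [y0|y0] := eqVneq y 0; last by right; rewrite (mulIf y0 ey).
by rewrite x0 y0 eqxx in nz.
Qed.

Lemma map2_eigen1 a (k : 'F_p) v : map2 a v = v *+ k -> v.1 = 0.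
Proof.
case: v => x y; rewrite plane_mulrn /map2 /= -!Fp_mulrn => e.
have /= ex := congr1 fst e; have /= ey := congr1 snd e.
apply/eqP; apply: contraT => x0; rewrite (mulIf x0 ex) in ey.
by rewrite -(negPf x0) -(inj_eq (addrI (k * y))) ey addr0.
Qed.

Lemma map2_eigen a (k : 'F_p) v : map2 a v = v *+ k -> v != 0 -> k = a.
Proof.
move=> e; have := map2_eigen1 e; case: v e => x y e /= x0; rewrite x0 in e *.
rewrite plane_mulrn /map2 /= addr0 -!Fp_mulrn in e; have /= ey := congr1 snd e.
have [->|y0 _] := eqVneq y 0; first by rewrite eqxx.
by rewrite (mulIf y0 ey).
Qed.

Lemma rack1_iso_params a b a' b' : unit_ne1 a -> unit_ne1 b -> unit_ne1 a' -> unit_ne1 b' ->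
  rack_iso (rack1 a b : V -> V -> V) (rack1 a' b') -> (a = a' \/ a = b') /\ (b = a' \/ b = b').
Proof.
move=> ua ub ua' ub' iso.
have [f [bij_f fD fM]] := rack_iso_additive (rack1E a b) (rack1E a' b')
  (map1_affine ua ub) (map1_affine ua' ub') iso.
split.
- apply: (@map1_eigen a' b' a (f (1, 0))); first by rewrite -fM map1_e1 morphDMn.
  by rewrite bij_morphD_neq0 ?plane_e1_neq0.
apply: (@map1_eigen a' b' b (f (0, 1))); first by rewrite -fM map1_e2 morphDMn.
by rewrite bij_morphD_neq0 ?plane_e2_neq0.
Qed.

Lemma rack1_iso a b a' b' : unit_ne1 a -> unit_ne1 b -> unit_ne1 a' -> unit_ne1 b' ->
  (rack_iso (rack1 a b : V -> V -> V) (rack1 a' b') <->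
    (a' = a /\ b' = b) \/ (a' = b /\ b' = a)).
Proof.
move=> ua ub ua' ub'; split=> [iso|].
  (* Both inclusions of eigenvalue sets are used: one alone would allow [a = b] with [a' != b']. *)
  have [h1 h2] := rack1_iso_params ua ub ua' ub' iso.
  have [h3 h4] := rack1_iso_params ua' ub' ua ub (rack_iso_sym iso).
  by case: h1 => ?; case: h2 => ?; case: h3 => ?; case: h4 => ?; subst; auto.
case=> [[-> ->]|[-> ->]]; first exact: rack_iso_refl.
pose swap (v : V) : V := (v.2, v.1).
by exists swap; split=> //; exists swap => [[]|[]].
Qed.

Lemma rack2_iso a a' : unit_ne1 a -> unit_ne1 a' ->
  (rack_iso (rack2 a : V -> V -> V) (rack2 a') <-> a' = a).
Proof.
move=> ua ua'; split=> [iso|->]; last exact: rack_iso_refl.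
have [f [bij_f fD fM]] := rack_iso_additive (rack2E a) (rack2E a')
  (map2_affine ua) (map2_affine ua') iso.
apply/esym/(@map2_eigen a' a (f (0, 1))); first by rewrite -fM map2_e2 morphDMn.
by rewrite bij_morphD_neq0 ?plane_e2_neq0.
Qed.

(** The [p] multiples of 1 already exhaust the roots of ['X^p - 'X]. *)
Lemma Frobenius_fixed_prime_subfield (x : F) : x ^+ p = x -> in_prime_subfield x.
Proof.
move=> xp; have p_gt0 := prime_gt0 p_pr.
pose s := [seq i%:R : F | i <- iota 0 p].
have uniq_s : uniq s.
  rewrite map_inj_in_uniq ?iota_uniq // => i j; rewrite !mem_iota !add0n /= => lt_ip lt_jp.
  wlog le_ij : i j lt_ip lt_jp / (i <= j)%N.
    by case: (leqP i j) => [|/ltnW] le_ij h; [apply: h | move=> /esym e; apply/esym/h].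
  move/eqP; rewrite eq_sym -subr_eq0 -natrB // -(dvdn_pcharf pcharF) => p_dv.
  apply/eqP; rewrite eqn_leq le_ij /= -subn_eq0; apply: contraTT p_dv; rewrite -lt0n => lt_0.
  by rewrite gtnNdvd // (leq_ltn_trans (leq_subr _ _)).
have [/mapP[i _ ->]|nsx] := boolP (x \in s); first by exists i.
have roots : all (root ('X^p - 'X : {poly F})) (x :: s).
  apply/allP => y; rewrite inE /root !hornerE subr_eq0 => /predU1P[->|/mapP[i _ ->]].
    by rewrite xp.
  by rewrite -[_ ^+ p]/(pFrobenius_aut pcharF _) rmorph_nat.
have sizeP : size ('X^p - 'X : {poly F}) = p.+1.
  by rewrite size_polyDl ?size_polyXn // size_polyN size_polyX ltnS prime_gt1.
have := max_poly_roots _ roots; rewrite -size_poly_eq0 sizeP /= nsx uniq_s size_map size_iota.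
by move=> /(_ isT isT); rewrite ltnn.
Qed.

(** The trace [t] and norm [n] of [a] lie in the prime subfield, so an additive intertwiner carries
    [a ^+ 2 = t a - n] over to [a'], whose only possible values are the roots [a] and [a ^+ p].
    Conversely Frobenius is an isomorphism. *)
Lemma rack3_iso (a a' : F) : ~ in_prime_subfield a -> ~ in_prime_subfield a' ->
  (rack_iso (rack3 a) (rack3 a') <-> a' = a \/ a' = a ^+ p).
Proof.
move=> na na'; split=> [iso|[->|->]]; last 2 first.
- exact: rack_iso_refl.
- exists (pFrobenius_aut pcharF); split.
    exact: injF_bij (fmorph_inj _).
  by move=> x y; rewrite /rack3 rmorphD !rmorphM rmorphB rmorph1.
have [f [bij_f fD fM]] := rack_iso_additive (rack3E a) (rack3E a')
  (not_prime_subfield_affine na) (not_prime_subfield_affine na') iso.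
have app : (a ^+ p) ^+ p = a by rewrite -exprM -{2}[p]expn1 -expnS -cardF expf_card.
have [t Dt] : in_prime_subfield (a + a ^+ p).
  apply: Frobenius_fixed_prime_subfield.
  by rewrite -[_ ^+ p]/(pFrobenius_aut pcharF _) rmorphD /= !pFrobenius_autE app addrC.
have [n Dn] : in_prime_subfield (a * a ^+ p).
  by apply: Frobenius_fixed_prime_subfield; rewrite exprMn app mulrC.
(* The products by [a] are kept iterated on 1 so that [fM] applies twice. *)
have Da2 : a * (a * 1) = (a * 1) *+ t - 1 *+ n.
  by rewrite -[_ *+ t]mulr_natl -Dt -Dn; ring.
have f1 : f 1 != 0 by rewrite bij_morphD_neq0 ?oner_neq0.
have : (a' - a) * (a' - a ^+ p) * f 1 = 0.
  have := congr1 f Da2; rewrite fD (morphDN fD) !(morphDMn fD) !fM => e.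
  have -> : (a' - a) * (a' - a ^+ p) * f 1 = a' * (a' * f 1) - ((a + a ^+ p) * (a' * f 1) - a * a ^+ p * f 1).
    by ring.
  by rewrite Dt Dn !mulr_natl e subrr.
move/eqP; rewrite !mulf_eq0 (negPf f1) orbF !subr_eq0.
by case/orP => /eqP; auto.
Qed.

(** An additive self-map of ['Z_m] is multiplication by [f 1], here a unit, so it can be
    cancelled. *)
Lemma Zp_intertwined_eq m (f : 'Z_m -> 'Z_m) (a a' : 'Z_m) :
  bijective f -> {morph f : x y / x + y} -> (forall x, f (a * x) = a' * f x) -> a' = a.
Proof.
move=> [g _ gK] fD fM.
have fE x : f x = f 1 * x.
  by rewrite -{1}[x]natr_Zp -[x in RHS]natr_Zp mulr_natr morphDMn.
have f1g : f 1 * g 1 = 1 by rewrite -fE gK.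
have := fM 1; rewrite mulr1 fE => /(congr1 (fun x => x * g 1)).
by rewrite mulrAC f1g -mulrA f1g mul1r mulr1.
Qed.

Lemma rack4_iso (a a' : 'Z_(p ^ 2)) : valid4 a -> valid4 a' ->
  (rack_iso (rack4 a) (rack4 a') <-> a' = a).
Proof.
move=> va va'; split=> [iso|->]; last exact: rack_iso_refl.
have [f [bij_f fD fM]] := rack_iso_additive (rack4E a) (rack4E a')
  (valid4_affine va) (valid4_affine va') iso.
exact: Zp_intertwined_eq bij_f fD fM.
Qed.

(* [op x] only depends on the first coordinate of [x], so an isomorphism induces
   one between the affine racks on first coordinates. *)
Lemma rack6_iso a a' : unit_ne1 a -> unit_ne1 a' ->
  (rack_iso (rack6 a : V -> V -> V) (rack6 a') <-> a' = a).
Proof.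
move=> /andP[a0 a1] /andP[a'0 a'1]; split=> [[f [bij_f fM]]|->]; last exact: rack_iso_refl.
have a'u : 1 - a' != 0 by rewrite subr_eq0 eq_sym.
pose g i := (f (i, 0)).1.
have gE x : (f x).1 = g x.1.
  have /(congr1 fst) /= : rack6 a' (f x) 0 = rack6 a' (f (x.1, 0)) 0.
    by have [h _ hK] := bij_f; rewrite -[0]hK -!fM /rack6.
  by move/addIr/(mulfI a'u).
have gM x y : g ((1 - a) * x + a * y) = (1 - a') * g x + a' * g y.
  by rewrite -(gE (rack6 a (x, 0) (y, 0))) fM.
have bij_g : bijective g.
  have /fin_all_exists[h hK] u : exists v, g v = u.
    by have [f' _ f'K] := bij_f; exists (f' (u, 0)).1; rewrite -gE f'K.
  have injh : injective h by apply: can_inj hK.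
  have [h' h'K hK'] := injF_bij injh; exists h => // x.
  by rewrite -[x]hK' hK.
have iso : rack_iso (rack3 a) (rack3 a') by exists g.
have affE (b : 'F_p) : rack3 b =2 affine_op (fun x => b * x).
  by move=> x y; rewrite /affine_op /rack3; ring.
have [h [bij_h hD hM]] := rack_iso_additive (affE a) (affE a')
  (field_mul_affine_map a0 a1) (field_mul_affine_map a'0 a'1) iso.
exact: Zp_intertwined_eq bij_h hD hM.
Qed.

(** Two isomorphism invariants: idempotence separates items (1) to (4) from (5) and (6), and
    independence of the first argument separates (5) from (6). *)
Definition idempotent_op (X : finType) (op : X -> X -> X) := forall x, op x x = x.
Definition constant_op (X : finType) (op : X -> X -> X) := forall x x' y, op x y = op x' y.

Lemma idempotent_op_iso (X Y : finType) (opX : X -> X -> X) (opY : Y -> Y -> Y) :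
  rack_iso opX opY -> idempotent_op opX <-> idempotent_op opY.
Proof.
move=> [f [[g fK gK] fM]]; split=> idem x; last by apply: (can_inj fK); rewrite fM idem.
by rewrite -[x]gK -fM idem.
Qed.

Lemma constant_op_iso (X Y : finType) (opX : X -> X -> X) (opY : Y -> Y -> Y) :
  rack_iso opX opY -> constant_op opX -> constant_op opY.
Proof.
by move=> [f [[g fK gK] fM]] cst x x' y; rewrite -[x]gK -[x']gK -[y]gK -!fM (cst _ (g x')).
Qed.

Lemma affine_op_idempotent (W : finZmodType) (b : W -> W) (opW : W -> W -> W) :
  affine_map b -> opW =2 affine_op b -> idempotent_op opW.
Proof. by move=> [bD _ _] eW x; rewrite eW /affine_op subrr (morphD0 bD) add0r. Qed.

(** * Separating the items *)

Section Disjoint.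

Variables (X : finType) (op : X -> X -> X).

Lemma item1_affine : in_item p F 1 op -> exists a b,
  [/\ affine_map (map1 a b), rack_iso op (rack1 a b) & rack1 a b =2 affine_op (map1 a b)].
Proof.
case=> a [b [ua ub iso]]; exists a, b; split=> //; first exact: map1_affine.
exact: rack1E.
Qed.

Lemma item2_affine : in_item p F 2 op -> exists a,
  [/\ affine_map (map2 a), rack_iso op (rack2 a) & rack2 a =2 affine_op (map2 a)].
Proof. by case=> a [ua iso]; exists a; split=> //; [exact: map2_affine | exact: rack2E]. Qed.

Lemma item3_affine : in_item p F 3 op -> exists a : F, [/\ affine_map (fun x => a * x),
  rack_iso op (rack3 a), rack3 a =2 affine_op (fun x => a * x) & ~ in_prime_subfield a].
Proof.
by case=> a [na iso]; exists a; split=> //; [exact: not_prime_subfield_affine | exact: rack3E].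
Qed.

Lemma item4_affine : in_item p F 4 op -> exists a : 'Z_(p ^ 2),
  [/\ affine_map (fun x => a * x), rack_iso op (rack4 a) & rack4 a =2 affine_op (fun x => a * x)].
Proof. by case=> a [va iso]; exists a; split=> //; [exact: valid4_affine | exact: rack4E]. Qed.

Lemma affine_items_idempotent i : (i <= 4)%N -> in_item p F i op -> idempotent_op op.
Proof.
case: i => [|[|[|[|[|]]]]] // _.
- by case/item1_affine=> a [b [aff iso e]]; apply/(idempotent_op_iso iso)/(affine_op_idempotent aff e).
- by case/item2_affine=> a [aff iso e]; apply/(idempotent_op_iso iso)/(affine_op_idempotent aff e).
- by case/item3_affine=> a [aff iso e _]; apply/(idempotent_op_iso iso)/(affine_op_idempotent aff e).
- by case/item4_affine=> a [aff iso e]; apply/(idempotent_op_iso iso)/(affine_op_idempotent aff e).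
Qed.

Lemma item5_not_idempotent : in_item p F 5 op -> ~ idempotent_op op.
Proof.
move=> iso /(idempotent_op_iso iso)/(_ 0)/eqP.
by rewrite /rack5 add0r oner_eq0.
Qed.

Lemma item6_not_idempotent : in_item p F 6 op -> ~ idempotent_op op.
Proof.
case=> a [_ iso] /(idempotent_op_iso iso)/(_ 0)/(congr1 snd)/eqP.
by rewrite /rack6 /= add0r oner_eq0.
Qed.

Lemma item56_disjoint : in_item p F 5 op -> ~ in_item p F 6 op.
Proof.
move=> iso5 [a [/andP[_ a1] iso6]].
have: constant_op (rack6 a).
  by apply: constant_op_iso (rack_iso_trans (rack_iso_sym iso5) iso6) _ => x x' y.
move=> /(_ 0 (1, 0) 0)/(congr1 fst)/eqP.
by rewrite /rack6 /= !mulr0 mulr1 !addr0 eq_sym subr_eq0 eq_sym (negPf a1).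
Qed.

(** An isomorphism would identify the additive groups, but [1 *+ p] is nonzero modulo [p ^ 2]. *)
Lemma exponent_p_disjoint4 (W : finZmodType) (b : W -> W) (opW : W -> W -> W) :
    affine_map b -> opW =2 affine_op b -> (forall w : W, w *+ p = 0) ->
  rack_iso op opW -> ~ in_item p F 4 op.
Proof.
move=> affb eW pW isoW /item4_affine[a [affa iso4 e4]].
have [f [bij_f fD _]] := rack_iso_additive e4 eW affa affb (rack_iso_trans (rack_iso_sym iso4) isoW).
have f1p : f (1 *+ p) = 0 by rewrite morphDMn.
have /eqP : (1 *+ p : 'Z_(p ^ 2)) != 0.
  rewrite -val_eqE /= val_Zp_nat // modn_small -?lt0n ?prime_gt0 //.
  by rewrite expnS expn1 ltn_Pmull ?prime_gt1 ?prime_gt0.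
by apply; apply: (bij_inj bij_f); rewrite f1p morphD0.
Qed.

(** The image of [w] is a nonzero element that [a] multiplies by [k], so [a] would lie in the prime
    subfield. *)
Lemma eigen_disjoint3 (W : finZmodType) (b : W -> W) (opW : W -> W -> W) (w : W) k :
    affine_map b -> opW =2 affine_op b -> b w = w *+ k -> w != 0 ->
  rack_iso op opW -> ~ in_item p F 3 op.
Proof.
move=> affb eW bw w0 isoW /item3_affine[a [affa iso3 e3 na]].
have [f [bij_f fD fM]] := rack_iso_additive eW e3 affb affa (rack_iso_trans (rack_iso_sym isoW) iso3).
have fw0 : f w != 0 by apply: bij_morphD_neq0.
apply: na; exists k; apply: (mulIf fw0).
by rewrite -fM bw morphDMn // mulr_natl.
Qed.

(** The two basis eigenvectors of item (1) would both land on the single eigenline of item (2),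
    against surjectivity. *)
Lemma item12_disjoint : in_item p F 1 op -> ~ in_item p F 2 op.
Proof.
case/item1_affine=> a [b [aff1 iso1 e1]] /item2_affine[a' [aff2 iso2 e2]].
have [f [bij_f fD fM]] := rack_iso_additive e1 e2 aff1 aff2 (rack_iso_trans (rack_iso_sym iso1) iso2).
have f1 : (f (1, 0)).1 = 0.
  by apply: (@map2_eigen1 a' a); rewrite -fM map1_e1 morphDMn.
have f2 : (f (0, 1)).1 = 0.
  by apply: (@map2_eigen1 a' b); rewrite -fM map1_e2 morphDMn.
have f0 v : (f v).1 = 0.
  have -> : v = (1, 0) *+ v.1 + (0, 1) *+ v.2 :> V.
    case: v => x y; rewrite !plane_mulrn /= !mul0rn !natr_Zp.
    by congr (_, _); rewrite ?addr0 ?add0r.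
  by rewrite fD !(morphDMn fD) !plane_mulrn /= f1 f2 !mul0rn addr0.
have [g _ gK] := bij_f; have := f0 (g (1, 0)); rewrite gK => /eqP.
by rewrite oner_eq0.
Qed.

Let F_p_exp (w : F) : w *+ p = 0.
Proof. by rewrite -mulr_natr pcharf0 ?mulr0. Qed.

Let V_p_exp (w : V) : w *+ p = 0.
Proof.
have p0 (x : 'F_p) : x *+ p = 0 by rewrite -mulr_natr pchar_Fp_0 ?mulr0.
by rewrite plane_mulrn !p0.
Qed.

Lemma items_disjoint_lt i j : (i < j)%N -> in_item p F i op -> ~ in_item p F j op.
Proof.
move=> lt_ij item_i; move: lt_ij.
case: j => [|[|[|[|[|[|[|j]]]]]]] // lt_ij item_j; rewrite ltnS in lt_ij.
- by case: i lt_ij item_i => [|[|]].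
- by case: i lt_ij item_i => [|[|[|]]] // _ /item12_disjoint.
- case: i lt_ij item_i => [|[|[|[|]]]] // _.
    move=> /item1_affine[a [b [aff iso e]]].
    exact: (eigen_disjoint3 aff e (map1_e1 a b) plane_e1_neq0 iso).
  move=> /item2_affine[a [aff iso e]].
  exact: (eigen_disjoint3 aff e (map2_e2 a) plane_e2_neq0 iso).
- case: i lt_ij item_i => [|[|[|[|[|]]]]] // _.
  + by move=> /item1_affine[a [b [aff iso e]]]; exact: (exponent_p_disjoint4 aff e V_p_exp iso).
  + by move=> /item2_affine[a [aff iso e]]; exact: (exponent_p_disjoint4 aff e V_p_exp iso).
  by move=> /item3_affine[a [aff iso e _]]; exact: (exponent_p_disjoint4 aff e F_p_exp iso).
- exact: item5_not_idempotent item_j (affine_items_idempotent lt_ij item_i).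
- rewrite leq_eqVlt ltnS in lt_ij; case/predU1P: lt_ij => [i5|lt_ij].
    by move: item_i; rewrite i5 => /item56_disjoint.
  exact: item6_not_idempotent item_j (affine_items_idempotent lt_ij item_i).
by [].
Qed.

Lemma items_disjoint i j : i <> j -> in_item p F i op -> ~ in_item p F j op.
Proof.
move=> /eqP; rewrite neq_ltn => /orP[lt_ij|lt_ji] item_i item_j.
  exact: items_disjoint_lt lt_ij item_i item_j.
exact: items_disjoint_lt lt_ji item_j item_i.
Qed.

End Disjoint.

End Items.

Theorem theorem2p1 (p : nat) (F : finFieldType) :
  prime p -> #|F| = (p ^ 2)%N ->
  (* classification *)
  (forall (X : finType) (op : X -> X -> X),
     is_rack op -> indecomposable op -> #|X| = (p ^ 2)%N ->
     exists i : nat, (1 <= i <= 6)%N /\ in_item p F i op) /\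
  (* racks from different items are not isomorphic *)
  (forall (i j : nat) (X : finType) (op : X -> X -> X),
     i <> j -> in_item p F i op -> ~ in_item p F j op) /\
  (* isomorphisms within item (1) *)
  (forall a b a' b' : 'F_p, unit_ne1 a -> unit_ne1 b -> unit_ne1 a' -> unit_ne1 b' ->
     (rack_iso (rack1 a b) (rack1 a' b') <->
      (a' = a /\ b' = b) \/ (a' = b /\ b' = a))) /\
  (* item (2) *)
  (forall a a' : 'F_p, unit_ne1 a -> unit_ne1 a' ->
     (rack_iso (rack2 a) (rack2 a') <-> a' = a)) /\
  (* item (3): sigma = Frobenius x |-> x^p, the nontrivial element of Gal(F_{p^2}|F_p) *)
  (forall a a' : F, ~ in_prime_subfield a -> ~ in_prime_subfield a' ->
     (rack_iso (rack3 a) (rack3 a') <-> a' = a \/ a' = a ^+ p)) /\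
  (* item (4) *)
  (forall a a' : 'Z_(p ^ 2), valid4 a -> valid4 a' ->
     (rack_iso (rack4 a) (rack4 a') <-> a' = a)) /\
  (* item (6) *)
  (forall a a' : 'F_p, unit_ne1 a -> unit_ne1 a' ->
     (rack_iso (rack6 a) (rack6 a') <-> a' = a)).
Proof.
move=> p_pr cardF; split; first by move=> X op; exact: indecomposable_rack_item.
split; first by move=> i j X op; exact: items_disjoint.
split; first exact: rack1_iso.
split; first exact: rack2_iso.
split; first exact: rack3_iso.
by split; [exact: rack4_iso | exact: rack6_iso].
Qed.
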